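(* Let $n>1$, let $\Gamma\subset\mathsf{PSL}(2,\mathbb{R})$ be a non-elementary discrete subgroup with $\Lambda(\Gamma)=\partial\mathbb{D}$, and let $\rho:\Gamma\to\mathsf{Sp}(2n,\mathbb{R})$ be a maximal representation with limit map $\xi^\alpha$ and induced map $\xi^1:\Lambda(\Gamma)\to\mathbb{P}(\bigwedge^n\mathbb{R}^{2n})$. For any three distinct points $x,y,z\in\Lambda(\Gamma)$, if the tangent line $\ell(z)$ exists, then the sum $$\xi^1(x)\oplus\xi^1(y)\oplus\mathrm{Ann}(\ell(z))$$ of subspaces of $\bigwedge^n\mathbb{R}^{2n}$ is a direct sum.
   Context: Hyperbolic plane and limit sets: $\mathbb{D}$ is the hyperbolic disk, $\mathsf{PSL}(2,\mathbb{R})=\mathrm{Isom}^+(\mathbb{D})$, $\partial\mathbb{D}=S^1$; $\Lambda(\Gamma)\subset\partial\mathbb{D}$ is the set of accumulation points of an orbit of $\Gamma$; $\Gamma$ is non-elementary if $|\Lambda(\Gamma)|>2$. A tuple of points of $S^1$ is positive if the points are (distinct and) cyclically ordered. Symplectic group and flags: $\Omega=\begin{pmatrix}0&\mathrm{Id}_n\\-\mathrm{Id}_n&0\end{pmatrix}$, $\mathsf{Sp}(2n,\mathbb{R})=\{g: g^T\Omega g=\Omega\}$. $\mathcal{F}_\alpha$ is the manifold of $n$-dimensional Lagrangian subspaces of $(\mathbb{R}^{2n},\Omega)$; $\mathcal{L}=\mathrm{Span}(e_1,\dots,e_n)$, $\mathcal{L}^{\mathrm{opp}}=\mathrm{Span}(e_{n+1},\dots,e_{2n})$.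 For symmetric $M$ put $U^M=\begin{pmatrix}\mathrm{Id}_n&M\\0&\mathrm{Id}_n\end{pmatrix}$. Every element of $\mathrm{Aut}(\mathfrak{sp}(2n,\mathbb{R}))$ is $\mathsf{Ad}_h$ with $h\in\mathsf{GL}(2n,\mathbb{R})$, $h^T\Omega h=\pm\Omega$, $h$ unique up to sign; it acts on $\mathcal{F}_\alpha$ by $W\mapsto hW$. Positivity and maximality: an $N$-tuple ($N\ge3$) in $\mathcal{F}_\alpha$ is positive if there are $g\in\mathrm{Aut}(\mathfrak{sp}(2n,\mathbb{R}))$ and $u_1,\dots,u_{N-2}\in\{U^M: M\text{ symmetric positive definite}\}$ with $(x_1,\dots,x_N)=g(\mathcal{L},u_1\cdots u_{N-2}\mathcal{L}^{\mathrm{opp}},\dots,u_1u_2\mathcal{L}^{\mathrm{opp}},u_1\mathcal{L}^{\mathrm{opp}},\mathcal{L}^{\mathrm{opp}})$. $\rho$ is maximal if there is a continuous $\rho$-equivariant map $\xi^\alpha:\Lambda(\Gamma)\to\mathcal{F}_\alpha$ sending positive tuples to positive tuples. Wedge space: $\xi^1(x)=\bigwedge^n\xi^\alpha(x)$, a line in $\bigwedge^n\mathbb{R}^{2n}$. The image $\xi^1(\Lambda(\Gamma))$ is known to be a rectifiable curve in $\mathbb{P}(\bigwedge^n\mathbb{R}^{2n})$; when the curve has a tangent line at $\xi^1(z)$, $\ell(z)$ denotes the projective tangent line, identified with a $2$-dimensional linear subspace of $\bigwedge^n\mathbb{R}^{2n}$ containing $\xi^1(z)$. The bilinear form $\omega'$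 on $\bigwedge^n\mathbb{R}^{2n}$ is defined by $v\wedge w=\omega'(v,w)\,e_1\wedge\cdots\wedge e_{2n}$ (nondegenerate, symmetric or skew-symmetric), and $\mathrm{Ann}(W)=\{w:\omega'(w,v)=0\ \forall v\in W\}$ for a subspace $W$. *)

(* Defs.v *)
From HB Require Import structures.
From mathcomp Require Import all_boot all_order all_algebra.
From mathcomp Require Import all_classical all_reals all_analysis.
From mathcomp Require Import complex ring.

Set Implicit Arguments.
Unset Strict Implicit.
Unset Printing Implicit Defensive.

Import Order.TTheory GRing.Theory Num.Theory.
Import numFieldNormedType.Exports.

Local Open Scope classical_set_scope.
Local Open Scope complex_scope.
Local Open Scope ring_scope.

(* The disk and its boundary live in R[i]; the alias R[i]^o is the copy of R[i]
   that carries the norm topology. *)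
Definition circle (R : realType) : set R[i]^o := [set w : R[i] | `|w| = 1].

(* The action of [[a, b], [c, d]] in SL(2,R) on the closed unit disk: the
   homography z |-> (a z + b) / (c z + d) of the upper half-plane, conjugated
   by the Cayley transform z |-> (z - i) / (z + i). It only depends on the
   class of the matrix modulo +1/-1. *)
Definition disk_action (R : realType) (g : 'M[R]_2) (w : R[i]) : R[i] :=
  let a := g 0 0 in let b := g 0 1 in let c := g 1 0 in let d := g 1 1 in
  (((a + d) +i* (b - c)) * w + ((a - d) -i* (b + c))) /
  (((a - d) +i* (b + c)) * w + ((a + d) -i* (b - c))).

(* A subset of PSL(2,R) = SL(2,R)/{1,-1} is encoded by its preimage in SL(2,R),
   i.e., by a set of matrices of determinant 1 stable under g |-> - g. *)
Definition psl_subgroup (R : realType) (G : set 'M[R]_2) : Prop :=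
  [/\ forall g, G g -> \det g = 1,
      G 1%:M,
      forall g, G g -> G (- g),
      forall g h, G g -> G h -> G (g *m h)
    & forall g, G g -> G (invmx g)].

(* As SL(2,R) -> PSL(2,R) is a covering map, a set is discrete in PSL(2,R) if
   and only if its preimage is discrete in SL(2,R). *)
Definition psl_discrete (R : realType) (G : set 'M[R]_2) : Prop :=
  G `<=` isolated G.

Definition limit_set (R : realType) (G : set 'M[R]_2) : set R[i]^o :=
  @circle R `&` limit_point ((fun g => disk_action g 0) @` G : set R[i]^o).

Definition non_elementary (R : realType) (G : set 'M[R]_2) : Prop :=
  ~~ (limit_set G #<= `I_2)%card.

(* Positive tuples of the circle: distinct points met in this order when
   turning once counterclockwise. *)
Definition positive_circle (R : realType) (s : seq R[i]) : Prop :=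
  exists t : seq R,
    [/\ sorted <%R t,
        {in t &, forall x y, y < x + pi *+ 2}
      & s = [seq cos x +i* sin x | x <- t]].

(* The k vectors whose coordinates in a fixed basis of V are the rows of A. *)
Definition frame (R : realType) (V : vectType R) (k : nat)
    (A : 'M[R]_(k, \dim {:V})) : k.-tuple V :=
  [tuple passmx.vecof (vbasis {:V}) (row i A) | i < k].

(* The open sets of Gr_k(V), for the quotient topology of the span map
   {linearly independent k-frames} -> Gr_k(V). Only the elements of U of
   dimension k matter. *)
Definition gr_open (R : realType) (V : vectType R) (k : nat)
    (U : set {vspace V}) : Prop :=
  open [set A : 'M[R]_(k, \dim {:V}) |
         free (frame A) /\ U <<frame A>>%VS].

Definition gr_continuous (R : realType) (V : vectType R) (k : nat)
    (D : set R[i]^o) (f : R[i] -> {vspace V}) : Prop :=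
  forall U : set {vspace V}, gr_open k U ->
  exists2 O : set R[i]^o, open O & D `&` f @^-1` U = D `&` O.

(* T is the projective tangent line at p of the subset C of P(V): the limit in
   Gr_2(V) of the secant lines p + q, as q in C \ {p} tends to p. (The limit is
   unique as soon as p is not isolated in C.) *)
Definition tangent_line (R : realType) (V : vectType R)
    (C : set {vspace V}) (p T : {vspace V}) : Prop :=
  [/\ \dim T = 2%N, (p <= T)%VS
    & forall U : set {vspace V}, gr_open 2 U -> U T ->
      exists O : set {vspace V},
        [/\ gr_open 1 O, O p
          & forall q, C q -> q <> p -> O q -> U (p + q)%VS]].

Definition Omega (R : realType) (n : nat) : 'M[R]_(n + n) :=
  block_mx 0 1%:M (- 1%:M) 0.

Definition Sp (R : realType) (n : nat) : set 'M[R]_(n + n) :=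
  [set g | g^T *m Omega R n *m g = Omega R n].

(* The h inducing the automorphisms Ad_h of the Lie algebra sp(2n,R). *)
Definition aut_sp (R : realType) (n : nat) : set 'M[R]_(n + n) :=
  [set h | h \in unitmx /\
     (h^T *m Omega R n *m h = Omega R n \/
      h^T *m Omega R n *m h = - Omega R n)].

Definition act (R : realType) (m : nat) (g : 'M[R]_m)
    (W : {vspace 'cV[R]_m}) : {vspace 'cV[R]_m} :=
  (linfun (mulmx g) @: W)%VS.

Definition lagrangian (R : realType) (n : nat)
    (W : {vspace 'cV[R]_(n + n)}) : Prop :=
  \dim W = n /\ {in W &, forall v w, v^T *m Omega R n *m w = 0}.

Definition Lag (R : realType) (n : nat) : {vspace 'cV[R]_(n + n)} :=
  <<[seq delta_mx (lshift n i) ord0 | i : 'I_n]>>%VS.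

Definition Lag_opp (R : realType) (n : nat) : {vspace 'cV[R]_(n + n)} :=
  <<[seq delta_mx (rshift n i) ord0 | i : 'I_n]>>%VS.

Definition unip (R : realType) (n : nat) (M : 'M[R]_n) : 'M[R]_(n + n) :=
  block_mx 1%:M M 0 1%:M.

Definition sym_posdef (R : realType) (n : nat) (M : 'M[R]_n) : Prop :=
  M^T = M /\ forall v : 'cV[R]_n, v != 0 -> 0 < (v^T *m M *m v) 0 0.

(* With N - 2 = size Ms, the product over take k Ms is u_1 ... u_k, and
   k = 0, 1, ..., N - 2 gives Lag_opp, u_1 Lag_opp, ..., in reverse order. *)
Definition positive_flags (R : realType) (n : nat)
    (s : seq {vspace 'cV[R]_(n + n)}) : Prop :=
  exists (h : 'M[R]_(n + n)) (Ms : seq 'M[R]_n),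
    [/\ aut_sp h, (0 < size Ms)%N, forall M, M \in Ms -> sym_posdef M
      & s = [seq act h W | W <- Lag R n ::
               rev [seq act (\big[mulmx/1%:M]_(M <- take k Ms) unip M)
                            (Lag_opp R n) | k <- iota 0 (size Ms).+1]]].

(* rho (- g) = rho g: rho is defined on the image of G in PSL(2,R). *)
Definition symplectic_rep (R : realType) (n : nat) (G : set 'M[R]_2)
    (rho : 'M[R]_2 -> 'M[R]_(n + n)) : Prop :=
  [/\ forall g, G g -> Sp (rho g),
      forall g h, G g -> G h -> rho (g *m h) = rho g *m rho h
    & forall g, G g -> rho (- g) = rho g].

Definition limit_map (R : realType) (n : nat) (G : set 'M[R]_2)
    (rho : 'M[R]_2 -> 'M[R]_(n + n))
    (xi : R[i] -> {vspace 'cV[R]_(n + n)}) : Prop :=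
  [/\ forall p, limit_set G p -> lagrangian (xi p),
      gr_continuous n (limit_set G) xi,
      forall g p, G g -> limit_set G p ->
        xi (disk_action g p) = act (rho g) (xi p)
    & forall s : seq R[i], (2 < size s)%N ->
        (forall p, p \in s -> limit_set G p) ->
        positive_circle s -> positive_flags [seq xi p | p <- s]].

Definition maximal_rep (R : realType) (n : nat) (G : set 'M[R]_2)
    (rho : 'M[R]_2 -> 'M[R]_(n + n)) : Prop :=
  exists xi, limit_map G rho xi.

(* The exterior algebra of R^m, in the basis e_S = e_{i_1} /\ ... /\ e_{i_k},
   S = {i_1 < ... < i_k}: v is the sum of the v S e_S. *)
Definition extalg (R : realType) (m : nat) : vectType R :=
  {ffun {set 'I_m} -> R^o}.

Definition ext_basis (R : realType) (m : nat) (S : {set 'I_m}) : extalg R m :=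
  [ffun A : {set 'I_m} => (A == S)%:R : R^o].

(* For disjoint A and B, e_A /\ e_B = (-1)^(inversions A B) e_(A :|: B). *)
Definition inversions (m : nat) (A B : {set 'I_m}) : nat :=
  #|[set ij : 'I_m * 'I_m | [&& ij.1 \in A, ij.2 \in B & (ij.2 < ij.1)%N]]|.

Definition wedge (R : realType) (m : nat) (v w : extalg R m) : extalg R m :=
  [ffun S : {set 'I_m} => \sum_(A : {set 'I_m} | A \subset S)
     (-1) ^+ inversions A (S :\: A) * (v A * w (S :\: A)) : R^o].

Definition ext_vec (R : realType) (m : nat) (v : 'cV[R]_m) : extalg R m :=
  \sum_(i < m) v i 0 *: ext_basis R [set i]%SET.

Definition ext_power (R : realType) (m k : nat) : {vspace extalg R m} :=
  <<[seq ext_basis R A | A : {set 'I_m} <- enum {set 'I_m} & #|A| == k]>>%VS.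

(* The line /\^k W for k = \dim W: it is spanned by the wedge product of the
   vectors of any basis of W. *)
Definition top_power (R : realType) (m : nat) (W : {vspace 'cV[R]_m}) :
    {vspace extalg R m} :=
  <[\big[@wedge R m/ext_basis R finset.set0]_(v <- vbasis W) ext_vec v]>%VS.

(* v /\ w = omega' v w e_1 /\ ... /\ e_2n for v, w in /\^n R^2n. *)
Definition omega' (R : realType) (n : nat) (v w : extalg R (n + n)) : R :=
  wedge v w [set: 'I_(n + n)]%SET.

Definition Ann (R : realType) (n : nat) (W : {vspace extalg R (n + n)}) :
    {vspace extalg R (n + n)} :=
  (ext_power R (n + n) n :&:
   \bigcap_(v <- vbasis W) lker (linfun (fun w => omega' w v : R^o)))%VS.

Lemma omega'_linearl (R : realType) (n : nat) (v : extalg R (n + n)) :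
  linear (fun w => omega' w v : R^o).
Proof.
move=> a u w; rewrite /omega' !ffunE scaler_sumr -big_split /=.
apply: eq_bigr => A _; rewrite !ffunE /= /GRing.scale /=.
ring.
Qed.

Lemma omega'_linearr (R : realType) (n : nat) (v : extalg R (n + n)) :
  linear (fun w => omega' v w : R^o).
Proof.
move=> a u w; rewrite /omega' !ffunE scaler_sumr -big_split /=.
apply: eq_bigr => A _; rewrite !ffunE /= /GRing.scale /=.
ring.
Qed.

Lemma memv_Ann (R : realType) (n : nat) (W : {vspace extalg R (n + n)})
    (w : extalg R (n + n)) :
  w \in Ann W <->
  w \in ext_power R (n + n) n /\ forall v, v \in W -> omega' w v = 0.
Proof.
have lf (v u : extalg R (n + n)) : linfun (fun w => omega' w v : R^o) u = omega' u v.
  pose f := GRing.isLinear.Build R _ _ _ _ (@omega'_linearl R n v).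
  pose F : {linear extalg R (n+n) -> R^o} := HB.pack (fun w => omega' w v : R^o) f.
  exact: (lfunE F).
rewrite memv_cap; split.
  case/andP=> -> h; split=> // v vW.
  pose g := GRing.isLinear.Build R _ _ _ _ (@omega'_linearr R n w).
  pose F : {linear extalg R (n+n) -> R^o} := HB.pack (fun v => omega' w v : R^o) g.
  rewrite -[LHS]/(F v) (coord_vbasis vW) linear_sum big1 // => i _.
  rewrite linearZ /=.
  have : w \in lker (linfun (fun u => omega' u (vbasis W)`_i : R^o)).
    apply: (subvP _ _ h).
    rewrite (big_nth 0) big_mkord.
    have hi : (i < size (vbasis W))%N by rewrite size_tuple.
    exact: (bigcapv_inf (Ordinal hi)).
  by rewrite memv_ker lf => /eqP ->; rewrite scaler0.
case=> -> h /=.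
rewrite big_seq.
apply: (big_ind (fun U : {vspace extalg R (n + n)} => w \in U)) => //.
- exact: memvf.
- by move=> U V hU hV; rewrite memv_cap hU.
- by move=> v /vbasis_mem vW; rewrite memv_ker lf h.
Qed.

(* Main.v *)
(* After a symplectic change of basis h, positivity of (y, x, z) puts xi y, xi x,
   xi z at Lag, the graph of 1 and Lag_opp, and for q between x and z the flag
   xi q is the graph of some P with 0 < P < 1. Let v_q be the Pluecker vector of
   xi q, so that v_z is the value at P = 0. Then omega'(v_y, v_q) = det h is
   constant, while omega'(v_x, v_q - v_z) = det h * (det(1 - P) - 1) has absolute
   value at least |det h| * tr P / n, and |v_q - v_z| <= C * tr P because
   Pluecker coordinates are polynomial in P. The resulting inequality
   |v_q - v_z| <= C' * |omega'(v_x, v_q - v_z)| is a closed condition on the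
   secants and passes to the tangent line: a nonzero w in l orthogonal to v_y is
   not orthogonal to v_x. Hence omega' pairs span(v_x, v_y) perfectly with l, so
   this span meets Ann l trivially. *)

Require Import Defs.
From HB Require Import structures.
From mathcomp Require Import all_boot all_order all_algebra.
From mathcomp Require Import all_classical all_reals all_analysis.
From mathcomp Require Import complex ring lra zify.

Set Implicit Arguments.
Unset Strict Implicit.
Unset Printing Implicit Defensive.

Import Order.TTheory GRing.Theory Num.Theory.
Import numFieldNormedType.Exports.

Local Open Scope ring_scope.

(** * Plücker coordinates *)

Lemma inversionsE (m : nat) (A B : {set 'I_m}) :
  inversions A B = (\sum_(i in A) \sum_(j in B) (j < i)%N)%N.
Proof.
rewrite /inversions -sum1_card pair_big_dep big_mkcond /= [RHS]big_mkcond /=.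
apply: eq_bigr => -[i j] _ /=.
set b := (X in if X then _ else _).
have -> : b = [&& i \in A, j \in B & (j < i)%N].
  by apply/idP/idP => [/set_mem|h]; last exact: mem_set.
by case: (i \in A); case: (j \in B); case: (j < i)%N.
Qed.

Lemma inversionsUr (m : nat) (A B C : {set 'I_m}) :
  [disjoint B & C] ->
  inversions A (B :|: C) = (inversions A B + inversions A C)%N.
Proof.
move=> BC; rewrite !inversionsE -big_split /=.
by apply: eq_bigr => i _; rewrite -bigU //; apply: eq_bigl => j; rewrite inE.
Qed.

Lemma inversionsUl (m : nat) (A B C : {set 'I_m}) :
  [disjoint A & B] ->
  inversions (A :|: B) C = (inversions A C + inversions B C)%N.
Proof. by move=> AB; rewrite !inversionsE -bigU //; apply: eq_bigl => j; rewrite inE. Qed.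

Section Wedge.
Variables (R : realType) (m : nat).
Implicit Types (u v w : extalg R m) (S : {set 'I_m}).

Lemma wedgeE u v S : wedge u v S = \sum_(A : {set 'I_m} | A \subset S)
  (-1) ^+ inversions A (S :\: A) * (u A * v (S :\: A)).
Proof. by rewrite ffunE. Qed.

(** Both sides are sums over the ordered partitions of [S] into three blocks [A], [B], [D]. Since
    [inversions] is additive in each argument over disjoint unions, both signs have exponent
    inv(A,B) + inv(A,D) + inv(B,D). *)
Lemma wedgeA : associative (@wedge R m).
Proof.
move=> u v w; apply/ffunP => S; rewrite !wedgeE.
under eq_bigr => A _ do rewrite wedgeE !mulr_sumr.
under [RHS]eq_bigr => C _ do rewrite wedgeE mulr_suml mulr_sumr.
rewrite [RHS](exchange_big_dep (fun A : {set 'I_m} => A \subset S)) /=; last first.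
  by move=> C A CS AC; apply: fintype.subset_trans CS.
apply: eq_bigr => A AS.
(* For fixed [A], the sets [C] with A ⊂ C ⊂ S correspond to the blocks B = C \ A of the left-hand
   side. *)
rewrite [RHS](reindex_onto (fun B : {set 'I_m} => A :|: B) (fun C : {set 'I_m} => C :\: A)) /=; last first.
  move=> C /andP[_ AC]; apply/setP => i; rewrite !inE.
  by case iA: (i \in A) => //=; rewrite (fintype.subsetP AC).
apply: eq_big => B.
  rewrite finset.subsetD finset.subsetUl andbT finset.subUset AS /=; congr andb.
  rewrite finset.setDUl finset.setDv finset.set0U.
  by apply/idP/eqP => /finset.setDidPl.
rewrite finset.subsetD => /andP[BS BA].
have AB : [disjoint A & B] by rewrite disjoint_sym.
have -> : (A :|: B) :\: A = B.
  by rewrite finset.setDUl finset.setDv finset.set0U; apply/finset.setDidPl.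
have -> : S :\: (A :|: B) = S :\: A :\: B by rewrite finset.setDDl.
set D := S :\: A :\: B.
have BD : [disjoint B & D].
  by rewrite -setI_eq0; apply/eqP/setP => i; rewrite !inE; case: (i \in B).
have -> : S :\: A = B :|: D.
  apply/setP => i; rewrite !inE; case iB: (i \in B) => //=.
  by rewrite (fintype.subsetP BS) ?(disjointFr BA).
have e : (inversions A (B :|: D) + inversions B D =
  inversions (A :|: B) D + inversions A B)%N.
  by rewrite inversionsUr // inversionsUl //; lia.
transitivity ((-1) ^+ (inversions A (B :|: D) + inversions B D) * (u A * v B * w D)).
  by rewrite exprD; ring.
by rewrite e exprD; ring.
Qed.

Lemma inversions0l (A : {set 'I_m}) : inversions finset.set0 A = 0%N.
Proof. by rewrite inversionsE big_set0. Qed.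

Lemma inversions0r (A : {set 'I_m}) : inversions A finset.set0 = 0%N.
Proof. by rewrite inversionsE big1 // => i _; rewrite big_set0. Qed.

Lemma ext_basisE A S : ext_basis R A S = (S == A)%:R.
Proof. by rewrite ffunE. Qed.

Lemma wedge1l : left_id (ext_basis R finset.set0) (@wedge R m).
Proof.
move=> u; apply/ffunP => S; rewrite wedgeE (bigD1 finset.set0) ?finset.sub0set //=.
rewrite big1 => [|A /andP[_ /negPf A0]]; last first.
  by rewrite ext_basisE A0 mul0r mulr0.
by rewrite ext_basisE eqxx finset.setD0 inversions0l expr0 !mul1r addr0.
Qed.

Lemma wedge1r : right_id (ext_basis R finset.set0) (@wedge R m).
Proof.
move=> u; apply/ffunP => S; rewrite wedgeE (bigD1 S) ?fintype.subxx //=.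
rewrite big1 => [|A /andP[AS AneS]]; last first.
  rewrite ext_basisE finset.setD_eq0 (_ : (S \subset A) = false) ?mulr0 //.
  by apply: contra_neqF AneS => SA; apply/eqP; rewrite finset.eqEsubset AS.
by rewrite ext_basisE finset.setDv eqxx inversions0r expr0 mul1r mulr1 addr0.
Qed.

HB.instance Definition _ := Monoid.isLaw.Build (extalg R m)
  (ext_basis R finset.set0) (@wedge R m) wedgeA wedge1l wedge1r.

Definition wedge_cols k (K : 'M[R]_(m, k)) : extalg R m :=
  \big[@wedge R m/ext_basis R finset.set0]_(j < k) ext_vec (col j K).

Lemma wedge_cols_row_mx k1 k2 (K1 : 'M[R]_(m, k1)) (K2 : 'M[R]_(m, k2)) :
  wedge_cols (row_mx K1 K2) = wedge (wedge_cols K1) (wedge_cols K2).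
Proof.
rewrite /wedge_cols big_split_ord /=; congr wedge; apply: eq_bigr => j _.
  by rewrite colKl.
by rewrite colKr.
Qed.

Lemma ext_vecE (v : 'cV[R]_m) S : ext_vec v S = \sum_i v i 0 * (S == [set i])%:R.
Proof. by rewrite sum_ffunE; apply: eq_bigr => i _; rewrite !ffunE. Qed.

(** For [s] in [S] this is the position of [s], counted from 0, in the increasing enumeration of
    [S]; it is also the exponent of the sign in a Laplace expansion. *)
Definition rank_in S (s : 'I_m) : nat := #|[set t in S | (t < s)%N]|.

Lemma rank_in_sum S s : rank_in S s = (\sum_(t in S) (t < s)%N)%N.
Proof.
rewrite /rank_in -sum1_card big_mkcond [RHS]big_mkcond /=.
by apply: eq_bigr => t _; rewrite inE; case: (t \in S); case: (t < s)%N.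
Qed.

Lemma rank_in_lt S s : s \in S -> (rank_in S s < #|S|)%N.
Proof.
move=> sS; apply: proper_card; apply/properP; split.
  by apply/fintype.subsetP => t; rewrite inE => /andP[].
by exists s => //; rewrite inE ltnn andbF.
Qed.

Lemma wedge_ext_vec (v : 'cV[R]_m) w S : wedge (ext_vec v) w S =
  \sum_(s in S) (-1) ^+ rank_in S s * (v s 0 * w (S :\ s)).
Proof.
rewrite wedgeE.
under eq_bigr => A _ do rewrite ext_vecE mulr_suml mulr_sumr.
rewrite exchange_big [RHS]big_mkcond; apply: eq_bigr => s _.
case: ifPn => sS; last first.
  rewrite big1 // => A AS; case: eqP => [eA|]; last by rewrite mulr0 mul0r mulr0.
  by move: AS; rewrite eA finset.sub1set (negPf sS).
rewrite (bigD1 [set s]) ?finset.sub1set //= big1 => [|A /andP[_ /negPf ->]]; last first.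
  by rewrite mulr0 mul0r mulr0.
rewrite addr0 eqxx mulr1 inversionsE big_set1; congr (_ ^+ _ * _).
rewrite rank_in_sum (big_setD1 s sS) /= ltnn add0n.
by [].
Qed.

(** Deleting [s] lowers by one the rank of exactly the elements beyond [s]. The form with [bump]
    matches the reindexing done by [row']. *)
Lemma rank_in_D1 S s t : s \in S -> t \in S -> t != s ->
  rank_in S t = bump (rank_in S s) (rank_in (S :\ s) t).
Proof.
move=> sS tS ts.
have e : rank_in S t = ((s < t)%N + rank_in (S :\ s) t)%N.
  by rewrite !rank_in_sum (big_setD1 s sS).
rewrite /bump e; congr addn.
have := ltn_neqAle s t; rewrite eq_sym ts /=.
have [st _|ts' _] := ltnP s t.
  suff : (rank_in S s < rank_in S t)%N by rewrite e st add1n ltnS => ->.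
  apply: proper_card; apply/properP; split.
    apply/fintype.subsetP => a; rewrite !inE => /andP[-> /=] /ltn_trans; exact.
  by exists s; rewrite !inE ?sS ?ltnn.
have lts : (t < s)%N by rewrite ltn_neqAle ts ts'.
suff : (rank_in S t < rank_in S s)%N by rewrite e (ltnNge s t) ts' add0n ltnNge => /negPf ->.
apply: proper_card; apply/properP; split.
  apply/fintype.subsetP => a; rewrite !inE => /andP[-> /=] /ltn_trans; exact.
by exists t; rewrite !inE ?tS ?ltnn.
Qed.

(* Left multiplication by [sel k S] extracts the rows with index in S, in
   increasing order, when #|S| = k. *)
Definition sel k S : 'M[R]_(k, m) :=
  \matrix_(r, s) ((s \in S) && (rank_in S s == r))%:R.

Lemma row'_sel k S s (K : 'M[R]_(m, k.+1)) (r : 'I_k.+1) :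
  s \in S -> rank_in S s = r ->
  row' r (col' 0 (sel k.+1 S *m K)) = sel k (S :\ s) *m col' 0 K.
Proof.
move=> sS rs; apply/matrixP => i j; rewrite !mxE.
apply: eq_bigr => t _; rewrite !mxE; congr (_%:R * _); congr nat_of_bool.
rewrite !inE; have [->|ts] := eqVneq t s.
  by rewrite sS rs /= (negPf (neq_bump _ _)).
case tS: (t \in S) => //=.
by rewrite (rank_in_D1 sS tS ts) rs (inj_eq (can_inj (bumpK _))).
Qed.

(* The Pluecker coordinates; the induction step is the Laplace expansion along
   the first column. *)
Lemma wedge_colsE k (K : 'M[R]_(m, k)) S :
  wedge_cols K S = (#|S| == k)%:R * \det (sel k S *m K).
Proof.
elim: k K S => [|k IH] K S.
  by rewrite /wedge_cols big_ord0 ext_basisE det_mx00 mulr1 cards_eq0.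
have -> : wedge_cols K = wedge (ext_vec (col 0 K)) (wedge_cols (col' 0 K)).
  rewrite /wedge_cols big_ord_recl; congr wedge; apply: eq_bigr => j _.
  by congr ext_vec; apply/matrixP => a b; rewrite !mxE.
rewrite wedge_ext_vec.
under eq_bigr => s sS do rewrite IH.
have [cS|cS] := eqVneq #|S| k.+1; last first.
  rewrite mul0r big1 // => s sS; rewrite (_ : _ == k = false) ?mul0r ?mulr0 //.
  by apply/negbTE; apply: contra cS; rewrite (cardsD1 s S) sS add1n eqSS.
rewrite mul1r (expand_det_col _ 0).
under [RHS]eq_bigr => r _ do rewrite mxE mulr_suml.
rewrite exchange_big /= big_mkcond; apply: eq_bigr => s _.
case: ifPn => sS; last first.
  by rewrite big1 // => r _; rewrite mxE (negPf sS) !mul0r.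
(* In the first column of [sel k.+1 S *m K], the entry of [K] in row [s] occurs only in the row
   indexed by the rank of [s]. *)
have rk : (rank_in S s < k.+1)%N by rewrite -cS rank_in_lt.
rewrite (bigD1 (Ordinal rk)) //= big1 ?addr0 => [|r rne]; last first.
  rewrite mxE sS /= (_ : _ == _ = false) ?mul0r //.
  by apply: contra_neqF rne => /eqP e; apply/val_inj; rewrite /= e.
rewrite !mxE sS eqxx mul1r /cofactor (row'_sel (s := s)) // addn0.
have -> : #|S :\ s| == k by rewrite -eqSS -cS (cardsD1 s S) sS add1n.
by rewrite mul1r mulrCA.
Qed.

(** A change of columns multiplies every maximal minor by the same factor [\det B]. *)
Lemma wedge_colsM k (K : 'M[R]_(m, k)) (B : 'M[R]_k) :
  wedge_cols (K *m B) = \det B *: wedge_cols K.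
Proof.
apply/ffunP => S; rewrite !ffunE !wedge_colsE mulmxA det_mulmx /GRing.scale /=.
ring.
Qed.

End Wedge.

Lemma sel_setT (R : realType) m : sel R m [set: 'I_m] = 1%:M.
Proof.
apply/matrixP => r s; rewrite !mxE inE /= eq_sym.
suff -> : rank_in [set: 'I_m] s = s by [].
rewrite rank_in_sum big_mkcond (eq_bigr (fun i : 'I_m => (i < s)%N : nat)).
  rewrite -big_mkcond -(big_ord_widen m (fun=> 1%N)) ?sum1_card ?card_ord //.
  exact: ltnW.
by move=> i _; rewrite inE.
Qed.

(** The coefficient on the full index set is the only maximal minor of the square matrix
    [row_mx K K']. *)
Lemma omega'_wedge_cols (R : realType) n (K K' : 'M[R]_(n + n, n)) :
  omega' (wedge_cols K) (wedge_cols K') = \det (row_mx K K').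
Proof.
by rewrite /omega' -wedge_cols_row_mx wedge_colsE sel_setT mul1mx cardsT card_ord eqxx mul1r.
Qed.

(** * Column spaces *)

Section ColumnSpace.
Variables (R : realType) (m : nat).

Definition colsp k (K : 'M[R]_(m, k)) : {vspace 'cV[R]_m} :=
  limg (linfun (mulmx K : 'cV[R]_k -> 'cV[R]_m)).

Definition cols_mx k (X : k.-tuple 'cV[R]_m) : 'M[R]_(m, k) :=
  \matrix_(i, j) tnth X j i 0.

Lemma memv_colspP k (K : 'M[R]_(m, k)) v :
  reflect (exists c : 'cV[R]_k, v = K *m c) (v \in colsp K).
Proof.
apply: (iffP memv_imgP) => [[c _ ->]|[c ->]]; exists c; rewrite ?memvf ?lfunE //.
Qed.

Lemma colspP k k' (K : 'M[R]_(m, k)) (K' : 'M[R]_(m, k')) :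
  (exists B, K = K' *m B) <-> (colsp K <= colsp K')%VS.
Proof.
split=> [[B ->]|sub].
  by apply/subvP => v /memv_colspP[c ->]; apply/memv_colspP; exists (B *m c); rewrite mulmxA.
have h j : {c : 'cV[R]_k' | col j K = K' *m c}.
  apply/cid/memv_colspP/(subvP sub)/memv_colspP.
  by exists (delta_mx j 0); rewrite colE.
exists (\matrix_(i, j) sval (h j) i 0).
apply/matrixP => i j; have /matrixP/(_ i 0) := svalP (h j); rewrite !mxE => ->.
by apply: eq_bigr => a _; rewrite !mxE.
Qed.

Lemma act_colsp k (g : 'M[R]_m) (K : 'M[R]_(m, k)) :
  act g (colsp K) = colsp (g *m K).
Proof.
rewrite /act /colsp -limg_comp; congr (_ @: _)%VS; apply/lfunP => c.
by rewrite comp_lfunE !lfunE /= mulmxA.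
Qed.

Lemma col_cols_mx k (X : k.-tuple 'cV[R]_m) j : col j (cols_mx X) = tnth X j.
Proof. by apply/matrixP => a b; rewrite !mxE ord1. Qed.

Lemma mul_cols_mx k (X : k.-tuple 'cV[R]_m) (c : 'cV[R]_k) :
  cols_mx X *m c = \sum_j c j 0 *: X`_j.
Proof.
apply/matrixP => i b; rewrite summxE !mxE ord1; apply: eq_bigr => j _.
by rewrite !mxE (tnth_nth 0) mulrC.
Qed.

Lemma span_colsp k (X : k.-tuple 'cV[R]_m) : <<X>>%VS = colsp (cols_mx X).
Proof.
apply/eqP; rewrite eqEsubv; apply/andP; split; apply/subvP => v.
  move=> /coord_span ->; apply/memv_colspP; exists (\col_j coord X j v).
  by rewrite mul_cols_mx; apply: eq_bigr => j _; rewrite mxE.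
case/memv_colspP => c ->; rewrite mul_cols_mx; apply: memv_suml => j _.
by apply/memvZ/memv_span/mem_nth; rewrite size_tuple.
Qed.

Lemma free_row_full k (X : k.-tuple 'cV[R]_m) : free X = row_full (cols_mx X).
Proof.
apply/freeP/idP => [h|/row_full_inj inj c].
  rewrite -cokermx_eq0; apply/eqP/matrixP => i j; rewrite [RHS]mxE.
  apply: (h (fun i => cokermx (cols_mx X) i j)).
  transitivity (cols_mx X *m col j (cokermx (cols_mx X))).
    by rewrite mul_cols_mx; apply: eq_bigr => a _; rewrite [col _ _ _ _]mxE.
  by rewrite colE mulmxA mulmx_coker mul0mx.
have -> : \sum_(i < k) c i *: X`_i = cols_mx X *m \col_i c i.
  by rewrite mul_cols_mx; apply: eq_bigr => a _; rewrite mxE.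
move=> h i; have : \col_i c i = 0 by apply: inj; rewrite h mulmx0.
by move/matrixP/(_ i 0); rewrite !mxE.
Qed.

Lemma dim_colsp k (K : 'M[R]_(m, k)) : row_full K -> \dim (colsp K) = k.
Proof.
case/row_fullP => B BK; rewrite limg_dim_eq ?dimvf; first by rewrite /dim /= muln1.
apply/eqP; rewrite -subv0; apply/subvP => c; rewrite memv_cap memvf /= memv_ker lfunE /= => /eqP Kc.
by rewrite memv0 -[c]mul1mx -BK -mulmxA Kc mulmx0.
Qed.

End ColumnSpace.

(** By Gaussian elimination [K] becomes [C *m pid_mx r] up to an invertible right factor. If r < k,
    a singular right factor splits off; if r = k, the columns left are the first [k] of the
    invertible [C], and their wedge with the other columns has coefficient [\det C] on the full
    set. *)
Lemma wedge_cols_neq0 (R : realType) m k (K : 'M[R]_(m, k)) :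
  (wedge_cols K != 0) = row_full K.
Proof.
rewrite -(mulmx_ebase K) /row_full.
rewrite mxrankMfree ?row_free_unit ?row_ebase_unit //.
have := rank_leq_col K; have := rank_leq_row K.
have := col_ebase_unit K; have := row_ebase_unit K.
move: (\rank K) (col_ebase K) (row_ebase K) => r C D Du Cu rm rk.
rewrite eqmxMfull ?row_full_unit // rank_pid_mx // wedge_colsM scaler_eq0 negb_or -unitfE -unitmxE Du /=.
have [rek|rnek] := eqVneq r k; last first.
  (* The idempotence of [pid_mx r] produces a square factor of size [k] and rank r < k, whose
     determinant vanishes. *)
  rewrite -(@pid_mx_id R m k k r rk) mulmxA wedge_colsM.
  suff -> : \det (pid_mx r : 'M[R]_k) = 0 by rewrite scale0r eqxx.
  apply/eqP; rewrite -[_ == 0]negbK -unitfE -unitmxE -row_full_unit /row_full.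
  by rewrite rank_pid_mx // (negPf rnek).
subst r; have [p mp] : exists p, m = (k + p)%N by exists (m - k)%N; rewrite subnKC.
subst m; move: (pid_mx_col R p k) => ->.
rewrite -[C]hsubmxK mul_row_col mulmx1 mulmx0 addr0.
apply/eqP => W0; move: Cu; rewrite unitmxE unitfE.
have := wedge_cols_row_mx (lsubmx C) (rsubmx C).
rewrite hsubmxK W0 => /ffunP/(_ [set: 'I_(k + p)]).
rewrite wedge_colsE sel_setT mul1mx cardsT card_ord eqxx mul1r => ->.
rewrite wedgeE big1 ?eqxx // => A _.
by rewrite ffunE mul0r mulr0.
Qed.

Section TopPower.
Variables (R : realType) (m : nat).

(** Two bases of the column space differ by an invertible [B], which only scales the wedge product
    by [\det B]; hence any frame may replace [vbasis]. *)
Lemma top_power_colsp k (K : 'M[R]_(m, k)) : row_full K ->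
  top_power (colsp K) = <[wedge_cols K]>%VS.
Proof.
move=> Kf.
have eqK := span_colsp (vbasis (colsp K)); rewrite (span_basis (vbasisP _)) in eqK.
have bf : row_full (cols_mx (vbasis (colsp K))).
  by rewrite -free_row_full; exact: basis_free (vbasisP _).
rewrite /top_power big_tuple.
have -> : \big[@wedge R m/ext_basis R finset.set0]_(i < \dim (colsp K))
   ext_vec (tnth (vbasis (colsp K)) i) = wedge_cols (cols_mx (vbasis (colsp K))).
  by apply: eq_bigr => i _; rewrite col_cols_mx.
(* The matrix is generalized because its number of columns is [\dim (colsp K)], which has to be
   turned into [k]. *)
move: (cols_mx _) bf eqK; rewrite (dim_colsp Kf) => K' Kf' e.
have [B BK] : exists B, K = K' *m B by apply/colspP; rewrite -e subvv.
have Bu : B \in unitmx.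
  rewrite -row_full_unit; move/row_fullP: Kf => [L].
  by rewrite BK mulmxA => LB; apply/row_fullP; exists (L *m K').
rewrite BK wedge_colsM; apply/eqP; rewrite eqEsubv; apply/andP; split; apply/vlineP.
  exists (\det B)^-1; rewrite scalerA mulVf ?scale1r //.
  by rewrite -unitfE.
by exists (\det B).
Qed.
End TopPower.

(** * Positive definite matrices *)

Section PositiveDefinite.
Variable R : realType.

Definition qform n (M : 'M[R]_n) (v : 'cV[R]_n) : R := (v^T *m M *m v) 0 0.

Lemma qformD n (M N : 'M[R]_n) v : qform (M + N) v = qform M v + qform N v.
Proof. by rewrite /qform mulmxDr mulmxDl mxE. Qed.

Lemma qformN n (M : 'M[R]_n) v : qform (- M) v = - qform M v.
Proof. by rewrite /qform mulmxN mulNmx mxE. Qed.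

Lemma sym_posdef_congr n (M A : 'M[R]_n) :
  A \in unitmx -> sym_posdef M -> sym_posdef (A *m M *m A^T).
Proof.
move=> Au [Ms Mp]; split; first by rewrite !trmx_mul trmxK Ms mulmxA.
move=> v v0; have := Mp (A^T *m v); rewrite trmx_mul trmxK !mulmxA; apply.
apply: contra v0 => /eqP e; apply/eqP.
by rewrite -[v](@mulKmx _ _ _ A^T) ?unitmx_tr // e mulmx0.
Qed.

Definition schur n (M : 'M[R]_(1 + n)) : 'M[R]_n :=
  drsubmx M - (M 0 0)^-1 *: (dlsubmx M *m (dlsubmx M)^T).

Definition schur_base n (M : 'M[R]_(1 + n)) : 'M[R]_(1 + n) :=
  block_mx 1%:M 0 ((M 0 0)^-1 *: dlsubmx M) 1%:M.

(** One step of symmetric Gaussian elimination; it drives the inductions on the size below. *)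
Lemma schur_factor n (M : 'M[R]_(1 + n)) : M^T = M -> M 0 0 != 0 ->
  M = schur_base M *m block_mx (M 0 0)%:M 0 0 (schur M) *m (schur_base M)^T.
Proof.
move=> Ms a0; rewrite /schur_base /schur.
have ur : ursubmx M = (dlsubmx M)^T by rewrite trmx_dlsub Ms.
have ul : ulsubmx M = (M 0 0)%:M.
  by rewrite [ulsubmx M]mx11_scalar !mxE; congr (M _ _)%:M; apply/val_inj.
rewrite -{1}[M]submxK ur ul tr_block_mx !mulmx_block.
rewrite !(mul1mx, mulmx1, mul0mx, mulmx0, addr0, add0r, trmx1, trmx0).
rewrite mul_mx_scalar mul_scalar_mx !linearZ /= !scalerA mulVf // !scale1r.
by rewrite linearN addrC subrK.
Qed.

Lemma schur_base_unit n (M : 'M[R]_(1 + n)) : schur_base M \in unitmx.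
Proof. by rewrite unitmxE det_lblock !det1 mulr1 unitr1. Qed.

Lemma sym_posdef_entry n (M : 'M[R]_n) i : sym_posdef M -> 0 < M i i.
Proof.
case=> _ /(_ (delta_mx i 0)); rewrite trmx_delta -rowE -colE !mxE; apply.
by apply/eqP => /matrixP/(_ i 0)/eqP; rewrite !mxE !eqxx oner_eq0.
Qed.

(** Congruence by the inverse of [schur_base M] makes [M] block diagonal with lower block [schur M];
    positivity is then tested on vectors with first coordinate 0. *)
Lemma sym_posdef_schur n (M : 'M[R]_(1 + n)) : sym_posdef M -> sym_posdef (schur M).
Proof.
move=> Mp; have [Ms _] := Mp.
have a0 : M 0 0 != 0 by rewrite gt_eqF ?sym_posdef_entry.
have Bu := schur_base_unit M.
have := @sym_posdef_congr _ M (invmx (schur_base M)); rewrite unitmx_inv => /(_ Bu Mp).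
rewrite {2}(schur_factor Ms a0) !mulmxA mulVmx // mul1mx -mulmxA -trmx_mul mulVmx //.
rewrite trmx1 mulmx1 => -[Ss Sp]; split.
  move: Ss; rewrite tr_block_mx => /eq_block_mx[_ _ _]; exact.
move=> v v0; have := Sp (col_mx 0 v).
rewrite tr_col_mx mul_row_block mul_row_col !(trmx0, mul0mx, mulmx0, add0r, addr0); apply.
by apply: contra v0 => /eqP; rewrite -[0 in RHS](@col_mx0 _ 1 n) => /eq_col_mx[_ ->].
Qed.

Lemma det_schur n (M : 'M[R]_(1 + n)) : sym_posdef M ->
  \det M = M 0 0 * \det (schur M).
Proof.
move=> Mp; have [Ms _] := Mp.
have a0 : M 0 0 != 0 by rewrite gt_eqF ?sym_posdef_entry.
rewrite {1}(schur_factor Ms a0) !det_mulmx det_tr det_lblock !det1 det_ublock.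
by rewrite det_scalar expr1 !mul1r mulr1.
Qed.

(** If the Schur complement is A A^T and s is the square root of the corner entry, the factor is
    [schur_base M] times diag(s, A). *)
Lemma cholesky n (M : 'M[R]_n) : sym_posdef M ->
  exists2 A : 'M[R]_n, A \in unitmx & M = A *m A^T.
Proof.
elim: n M => [|n IH] M Mp.
  by exists 1%:M; rewrite ?unitmx1 //; apply/matrixP => -[].
have [Ms _] := Mp.
have a0 : 0 < M 0 0 by apply: sym_posdef_entry.
have [A Au SA] := IH _ (sym_posdef_schur (Mp : sym_posdef (M : 'M[R]_(1 + n)))).
have [s s0 ss] : exists2 s : R, s != 0 & s * s = M 0 0.
  exists (Num.sqrt (M 0 0)); first by rewrite gt_eqF ?sqrtr_gt0.
  by rewrite -expr2 sqr_sqrtr ?ltW.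
exists (schur_base M *m (block_mx s%:M 0 0 A : 'M[R]_(1 + n))).
  have Bu : (block_mx s%:M 0 0 A : 'M[R]_(1 + n)) \in unitmx.
    by rewrite unitmxE det_lblock det_scalar expr1 unitrM -unitmxE Au unitfE s0.
  by rewrite unitmx_mul schur_base_unit Bu.
rewrite {1}(@schur_factor n M) ?gt_eqF // trmx_mul !mulmxA; congr (_ *m _).
rewrite -mulmxA; congr (_ *m _).
rewrite (@tr_block_mx _ 1 n 1 n) (@mulmx_block _ 1 n 1 n 1 n) !trmx0.
by rewrite !(mulmx0, mul0mx, addr0, add0r) -SA tr_scalar_mx -scalar_mxM ss.
Qed.

Lemma qform_col0 n (M : 'M[R]_(1 + n)) (v : 'cV[R]_n) :
  qform M (col_mx 0 v) = qform (drsubmx M) v.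
Proof.
rewrite /qform -{1}[M]submxK tr_col_mx mul_row_block mul_row_col.
by rewrite !(trmx0, mul0mx, mulmx0, add0r, addr0).
Qed.

(** The Schur complement is the lower right block minus a nonnegative form of rank at most one. *)
Lemma qform_schur_le n (M : 'M[R]_(1 + n)) (v : 'cV[R]_n) : sym_posdef M ->
  qform (schur M) v <= qform M (col_mx 0 v).
Proof.
move=> Mp; rewrite qform_col0 qformD qformN lerBlDr lerDl.
rewrite /qform -scalemxAr -scalemxAl mxE mulr_ge0 ?invr_ge0 ?(ltW (sym_posdef_entry _ Mp)) //.
rewrite (_ : _ *m v = (v^T *m dlsubmx M) *m (v^T *m dlsubmx M)^T); last first.
  by rewrite trmx_mul trmxK !mulmxA.
rewrite mxE sumr_ge0 // => i _.
by rewrite [X in _ * X]mxE -expr2 sqr_ge0.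
Qed.

Lemma trace_schur_le n (M : 'M[R]_(1 + n)) : sym_posdef M ->
  M 0 0 + \tr (schur M) <= \tr M.
Proof.
move=> Mp.
have -> : \tr M = M 0 0 + \tr (drsubmx M).
  rewrite -{1}[M]submxK mxtrace_block; congr (_ + _).
  by rewrite /mxtrace big_ord1 !mxE; congr (M _ _); apply/val_inj.
rewrite lerD2l /schur linearB /= lerBlDr lerDl mxtraceZ.
rewrite mulr_ge0 ?invr_ge0 ?(ltW (sym_posdef_entry _ Mp)) //.
apply: sumr_ge0 => i _; rewrite mxE sumr_ge0 // => j _.
by rewrite [X in _ * X]mxE -expr2 sqr_ge0.
Qed.

(** In terms of eigenvalues: all of them lie in (0, 1], so their product is at most each of them.
    The induction avoids eigenvalues: [\det Q] is the corner entry times the determinant of the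
    Schur complement, both factors are at most 1, so it is bounded by either one. *)
Lemma det_le_trace n (Q : 'M[R]_n) : sym_posdef Q ->
  (forall v, qform Q v <= qform 1%:M v) ->
  [/\ 0 < \det Q, \det Q <= 1 & n%:R * \det Q <= \tr Q].
Proof.
elim: n Q => [|n IH] Q Qp Q1.
  by rewrite det_mx00 mul0r /mxtrace big_ord0.
have a0 : 0 < Q 0 0 by apply: sym_posdef_entry.
have a1 : Q 0 0 <= 1.
  have := Q1 (delta_mx 0 0).
  by rewrite /qform !trmx_delta -!rowE -!colE !mxE.
have [||S0 S1 St] := IH (schur (Q : 'M[R]_(1 + n))).
- exact: sym_posdef_schur.
- move=> v; apply: le_trans (qform_schur_le v (Qp : sym_posdef (Q : 'M[R]_(1 + n)))) _.
  apply: le_trans (Q1 _) _; rewrite (@qform_col0 n) (_ : drsubmx _ = 1%:M) //.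
  by apply/matrixP => i j; rewrite !mxE (inj_eq (@rshift_inj 1 n)).
have trQ := @trace_schur_le n Q Qp.
rewrite (@det_schur n) //.
split; first by rewrite mulr_gt0.
  by rewrite mulr_ile1 // ltW.
apply: le_trans trQ; rewrite -natr1 mulrDl mul1r addrC; apply: lerD.
  by rewrite ler_piMr // ltW.
apply: le_trans St; rewrite ler_wpM2l ?ler0n //.
by rewrite ler_piMl // ltW.
Qed.

(** Positivity on e_i + e_j and e_i - e_j gives 2 |P_ij| <= P_ii + P_jj, and each diagonal entry is
    at most the trace. *)
Lemma sym_posdef_entry_le n (P : 'M[R]_n) i j : sym_posdef P -> `|P i j| <= \tr P.
Proof.
move=> Pp; have [Ps _] := Pp.
have dle k : P k k <= \tr P.
  by rewrite /mxtrace (bigD1 k) //= lerDl sumr_ge0 // => l _; rewrite ltW ?sym_posdef_entry.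
have q0 v : 0 <= qform P v.
  have [->|v0] := eqVneq v 0; first by rewrite /qform mulmx0 mxE.
  by rewrite ltW //; apply: (proj2 Pp).
have q (s : R) : qform P (delta_mx i 0 + s *: delta_mx j 0) =
    P i i + s * P i j + s * P j i + s * s * P j j.
  have vT : (delta_mx i 0 + s *: delta_mx j 0 : 'cV[R]_n)^T =
      delta_mx 0 i + s *: delta_mx 0 j by rewrite linearD linearZ /= !trmx_delta.
  rewrite /qform vT !mulmxDl !mulmxDr -!scalemxAl -!scalemxAr -!rowE -!colE.
  by rewrite !mxE; ring.
have Pji : P j i = P i j by rewrite -{1}Ps mxE.
have := q0 (delta_mx i 0 + 1 *: delta_mx j 0); have := q0 (delta_mx i 0 + -1 *: delta_mx j 0).
rewrite !q Pji => h1 h2; have := dle i; have := dle j => h3 h4.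
rewrite ler_norml; apply/andP; split; lra.
Qed.

(** This is [det_le_trace] for 1 - P, whose trace is n - tr P. The first bound makes the drop of the
    determinant at least linear in [P]; the second keeps [P] in a bounded region. *)
Lemma det_1B_bound n (P : 'M[R]_n) : sym_posdef P -> sym_posdef (1%:M - P) ->
  \tr P <= n%:R * (1 - \det (1%:M - P)) /\ \tr P <= n%:R.
Proof.
move=> Pp Qp; have [|d0 d1 dt] := det_le_trace Qp.
  move=> v; rewrite qformD qformN lerBlDr lerDl.
  have [->|v0] := eqVneq v 0; first by rewrite /qform mulmx0 mxE.
  by rewrite ltW //; apply: (proj2 Pp).
move: dt; rewrite linearB /= mxtrace1 => dt.
have := mulr_ge0 (ler0n R n) (ltW d0).
by split; lra.
Qed.

Lemma sym_posdef_trace_gt0 n (P : 'M[R]_n) : (0 < n)%N -> sym_posdef P -> 0 < \tr P.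
Proof.
case: n P => // n P _ Pp; rewrite /mxtrace (bigD1 ord0) //= ltr_wpDr ?sym_posdef_entry //.
by rewrite sumr_ge0 // => i _; rewrite ltW ?sym_posdef_entry.
Qed.

End PositiveDefinite.

(** * Open sets of Grassmannians *)

Section PolynomialFunctions.
Variables (R : realType) (I T : Type) (g : I -> T -> R).

(** Polynomial expressions in the generators [g i], given inductively so that Lipschitz estimates
    and continuity both follow by structural induction. *)
Inductive polyfun : (T -> R) -> Prop :=
| polyfun_gen i : polyfun (g i)
| polyfun_cst c : polyfun (fun=> c)
| polyfun_add f f' : polyfun f -> polyfun f' -> polyfun (fun t => f t + f' t)
| polyfun_mul f f' : polyfun f -> polyfun f' -> polyfun (fun t => f t * f' t).

Lemma polyfun_sum (J : Type) (r : seq J) (P : pred J) (f : J -> T -> R) :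
  (forall j, polyfun (f j)) -> polyfun (fun t => \sum_(j <- r | P j) f j t).
Proof.
move=> fp; elim: r => [|j r IH].
  by under eq_fun do rewrite big_nil; exact: polyfun_cst.
under eq_fun do rewrite big_cons; case: (P j) => //.
exact: polyfun_add.
Qed.

Lemma polyfun_prod (J : Type) (r : seq J) (P : pred J) (f : J -> T -> R) :
  (forall j, polyfun (f j)) -> polyfun (fun t => \prod_(j <- r | P j) f j t).
Proof.
move=> fp; elim: r => [|j r IH].
  by under eq_fun do rewrite big_nil; exact: polyfun_cst.
under eq_fun do rewrite big_cons; case: (P j) => //.
exact: polyfun_mul.
Qed.

Lemma polyfun_det k (M : T -> 'M[R]_k) :
  (forall i j, polyfun (fun t => M t i j)) -> polyfun (fun t => \det (M t)).
Proof.
move=> Mp; apply: polyfun_sum => s; apply: polyfun_mul; first exact: polyfun_cst.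
by apply: polyfun_prod => i; exact: Mp.
Qed.

Lemma polyfun_mulmxl p q k (A : 'M[R]_(p, q)) (M : T -> 'M[R]_(q, k)) :
  (forall i j, polyfun (fun t => M t i j)) ->
  forall i j, polyfun (fun t => (A *m M t) i j).
Proof.
move=> Mp i j; under eq_fun do rewrite mxE.
by apply: polyfun_sum => l; apply: polyfun_mul => //; exact: polyfun_cst.
Qed.

Lemma polyfun_wedge_cols m k (K : T -> 'M[R]_(m, k)) S :
  (forall i j, polyfun (fun t => K t i j)) ->
  polyfun (fun t => wedge_cols (K t) S).
Proof.
move=> Kp; under eq_fun do rewrite wedge_colsE.
apply: polyfun_mul; first exact: polyfun_cst.
by apply: polyfun_det; exact: polyfun_mulmxl.
Qed.

(** Here [d] acts as a bounded distance to [t0], and [t0] may lie outside [D]; the zero matrix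
    enters later in this way. *)
Lemma polyfun_lipschitz (D : set T) (t0 : T) (d : T -> R) (b : R) :
  (forall t, D t -> 0 <= d t <= b) ->
  (forall i, exists C, forall t, D t -> `|g i t - g i t0| <= C * d t) ->
  forall f, polyfun f -> exists C, forall t, D t -> `|f t - f t0| <= C * d t.
Proof.
move=> db gl f; elim=> {f} [//|c|f f' _ [C fC] _ [C' fC']|f f' _ [C fC] _ [C' fC']].
- by exists 0 => t _; rewrite subrr normr0 mul0r.
- exists (C + C') => t Dt; rewrite opprD addrACA mulrDl.
  exact: (le_trans (ler_normD _ _) (lerD (fC _ Dt) (fC' _ Dt))).
(* From f f' - f0 f0' = (f - f0) f' + f0 (f' - f0'), where |f'| <= |f' t0| + |C'| b on [D]. Absolute
   values are taken since [C] and [C'] may be negative. *)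
exists (`|C| * (`|f' t0| + `|C'| * b) + `|f t0| * C') => t Dt.
have /andP[d0 d1] := db _ Dt.
have -> : f t * f' t - f t0 * f' t0 = (f t - f t0) * f' t + f t0 * (f' t - f' t0) by ring.
rewrite [leRHS]mulrDl; apply: (le_trans (ler_normD _ _)); apply: lerD; rewrite normrM; last first.
  by rewrite -mulrA ler_wpM2l // fC'.
rewrite mulrAC ler_pM //.
  by rewrite (le_trans (fC _ Dt)) // ler_wpM2r // ler_norm.
rewrite -[f' t](subrKC (f' t0)); apply: (le_trans (ler_normD _ _)); rewrite lerD2l.
apply: (le_trans (fC' _ Dt)); apply: (@le_trans _ _ (`|C'| * d t)).
  by rewrite ler_wpM2r // ler_norm.
by rewrite ler_wpM2l.
Qed.

End PolynomialFunctions.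

Lemma polyfun_continuous (R : realType) (I : Type) (T : topologicalType)
    (g : I -> T -> R) :
  (forall i, continuous (g i)) -> forall f, polyfun g f -> continuous f.
Proof.
move=> gc f; elim=> {f} [//|c|f f' _ fc _ fc'|f f' _ fc _ fc'] t.
- exact: cvg_cst.
- exact: (cvgD (fc t) (fc' t)).
- exact: (cvgM (fc t) (fc' t)).
Qed.

Lemma continuous_mx (R : realType) (T : topologicalType) p q (f : T -> 'M[R]_(p, q)) :
  (forall i j, continuous (fun t => f t i j)) -> continuous f.
Proof.
move=> fc t U [P Pn PU]; rewrite nbhs_simpl /=.
have : nbhs t [set s | forall i j, P i j (f s i j)]%classic.
  by apply: filter_forall => i; apply: filter_forall => j; exact: fc _ _ _ (Pn i j).
by apply: filterS => s; exact: PU.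
Qed.

Section GrassmannianTopology.
Variable R : realType.

Definition entry p q (ij : 'I_p * 'I_q) (A : 'M[R]_(p, q)) : R := A ij.1 ij.2.

Lemma entry_continuous p q ij : continuous (@entry p q ij).
Proof. exact: coord_continuous. Qed.

Lemma polyfun_frame (V : vectType R) k (f : {linear V -> R^o}) (i : 'I_k) :
  polyfun (@entry k (\dim {:V})) (fun A => f (tnth (frame A) i)).
Proof.
under eq_fun => A.
  rewrite tnth_mktuple /passmx.vecof linear_sum.
  under eq_bigr => j _ do rewrite linearZ mxE /=.
  over.
apply: polyfun_sum => j; apply: polyfun_mul; last exact: polyfun_cst.
exact: (polyfun_gen _ (i, j)).
Qed.

Lemma tuple2E (V : Type) (X : 2.-tuple V) : X = [:: tnth X 0; tnth X 1] :> seq V.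
Proof. by case/tupleP: X => a X; case/tupleP: X => b X; rewrite (tuple0 X). Qed.

(** A plane on which [phi] is not zero meets ker phi in a line, spanned by a vector [w A] that is
    polynomial in the frame [A]. The condition on the plane is therefore a strict inequality between
    continuous functions of [A]. *)
Lemma gr_open_cone (V : vectType R) (phi psi chi : {linear V -> R^o}) :
  gr_open 2 [set W : {vspace V} | (exists2 u, u \in W & phi u != 0) /\
    exists w, [/\ w \in W, phi w = 0 & `|psi w| < `|chi w| ] ]%classic.
Proof.
pose w (A : 'M[R]_(2, \dim {:V})) := phi (tnth (frame A) 1) *: tnth (frame A) 0 -
  phi (tnth (frame A) 0) *: tnth (frame A) 1.
have wp (f : {linear V -> R^o}) : continuous (fun A => f (w A)).
  apply: (polyfun_continuous (@entry_continuous _ _)).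
  have -> : (fun A => f (w A)) = (fun A => phi (tnth (frame A) 1) * f (tnth (frame A) 0) +
     (-1) * (phi (tnth (frame A) 0) * f (tnth (frame A) 1))).
    apply/funext => A; rewrite /w linearB mulN1r.
    by congr (_ - _); exact: linearZ.
  apply: polyfun_add; last (apply: polyfun_mul; first exact: polyfun_cst);
    by apply: polyfun_mul; exact: polyfun_frame.
have fZ (f : {linear V -> R^o}) c v : f (c *: v) = c * f v by exact: linearZ.
have span2 (A : 'M[R]_(2, \dim {:V})) : <<frame A>>%VS = (<[tnth (frame A) 0%R]> + <[tnth (frame A) 1%R]>)%VS.
  by rewrite {1}(tuple2E (frame A)) span_cons span_seq1.
have wW A : w A \in <<frame A>>%VS by rewrite rpredB // rpredZ // memv_span // mem_tnth.
have w_free A : w A != 0 -> free (frame A).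
  rewrite (tuple2E (frame A)) free_cons span_seq1 seq1_free => w0.
  apply/andP; split; apply: contra w0.
    by move=> /vlineP[c e]; rewrite /w e fZ scalerA mulrC subrr.
  by move=> /eqP e; rewrite /w e linear0 scale0r scaler0 subrr.
have w_phi A : w A != 0 -> exists2 u, u \in <<frame A>>%VS & phi u != 0.
  move=> w0; have [e0|n0] := eqVneq (phi (tnth (frame A) 0)) 0; last first.
    by exists (tnth (frame A) 0); rewrite // memv_span // mem_tnth.
  exists (tnth (frame A) 1); first by rewrite memv_span // mem_tnth.
  by apply: contra w0 => /eqP e1; rewrite /w e0 e1 !scale0r subrr.
have phiw A : phi (w A) = 0.
  by rewrite /w linearB !fZ mulrC subrr.
(* Vectors of the plane killed by [phi] are proportional to [w A]. The factor [c] is a value of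
   [phi] on one of the two frame vectors, chosen nonzero. *)
have line A v : v \in <<frame A>>%VS -> phi v = 0 ->
    (exists2 u, u \in <<frame A>>%VS & phi u != 0) -> exists2 c, c != 0 & exists b, c *: v = b *: w A.
  rewrite span2 => /memv_addP[_ /vlineP[a ->] [_ /vlineP[b ->] ->]].
  set x := tnth _ 0; set y := tnth _ 1; rewrite linearD !fZ => ab.
  case=> _ /memv_addP[_ /vlineP[a' ->] [_ /vlineP[b' ->] ->]].
  rewrite linearD !fZ => ab0.
  have e1 : a * phi x = - (b * phi y) by apply/eqP; rewrite -addr_eq0; apply/eqP.
  have [y0|y0] := eqVneq (phi y) 0; last first.
    exists (phi y) => //; exists a; rewrite /w -/x -/y.
    by rewrite scalerDr scalerBr !scalerA (mulrC (phi y) a) e1 scaleNr opprK [phi y * b]mulrC.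
  exists (phi x).
    by apply: contra ab0 => /eqP x0; rewrite x0 y0 !mulr0 addr0.
  exists (- b); rewrite /w -/x -/y.
  rewrite scalerDr scalerBr !scalerA (mulrC (phi x) a) e1.
  by rewrite !(scaleNr, mulNr, opprK) (mulrC b (phi x)).
(* The inequality at [w A] alone describes the set: it forces [w A] to be nonzero, hence the frame
   to be free and [phi] to be nonzero on its span. *)
rewrite /gr_open (_ : mkset _ = [set A | 0 < `|chi (w A)| - `|psi (w A)|]%classic).
  apply: (@open_comp _ _ (fun A => `|chi (w A)| - `|psi (w A)|) [set x | 0 < x]%classic); last exact: open_gt.
  by move=> A _; exact: (cvgB (cvg_norm (wp chi A)) (cvg_norm (wp psi A))).
apply/seteqP; split=> A /=; rewrite subr_gt0.
  move=> [_ [ex [v [vA v0 lt]]]].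
  have [c c0 [b e]] := line A v vA v0 ex.
  have ns (f : {linear V -> R^o}) : `|c| * `|f v| = `|b| * `|f (w A)|.
    rewrite -!normrM; congr `|_|.
    by rewrite -!fZ e.
  have : `|c| * `|psi v| < `|c| * `|chi v| by rewrite ltr_pM2l ?normr_gt0.
  rewrite !ns => h; have b0 : b != 0.
    by apply: contraTneq h => ->; rewrite normr0 !mul0r ltxx.
  by rewrite -(ltr_pM2l (_ : 0 < `|b|)) ?normr_gt0.
move=> lt; have w0 : w A != 0.
  by apply: contraTneq lt => ->; rewrite !linear0 normr0 ltxx.
split; first exact: w_free.
by split; [exact: w_phi | exists (w A)].
Qed.

(** Continuity of the Plücker embedding: on frames it is a polynomial map, and a frame is free
    exactly when its wedge product is nonzero. *)
Lemma gr_open_top_power m k (O : set {vspace extalg R m}) :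
  gr_open 1 O ->
  gr_open k [set W : {vspace 'cV[R]_m} | O (top_power W)]%classic.
Proof.
move=> Oo; pose K (A : 'M[R]_(k, \dim {: 'cV[R]_m})) := cols_mx (frame A).
pose e := vbasis {: extalg R m}.
(* [B A] is the wedge product of the frame [A], written in coordinates as a frame of one vector. *)
pose B A : 'M[R]_(1, \dim {: extalg R m}) := passmx.rVof e (wedge_cols (K A)).
have frameB A : frame (B A) = [tuple wedge_cols (K A)].
  apply/val_inj; rewrite /= enum_ordSl enum_ord0 /=.
  rewrite (_ : row _ _ = B A) ?passmx.rVofK ?vbasisP //.
  by apply/rowP => j; rewrite mxE; congr (B A _ j); apply/val_inj.
have Bc : continuous B.
  apply: continuous_mx => i j; apply: (polyfun_continuous (@entry_continuous _ _)).
  have -> : (fun A => B A i j) = fun A =>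
      \sum_(S : {set 'I_m}) wedge_cols (K A) S * coord e j (ext_basis R S).
    apply/funext => A; rewrite mxE; rewrite -[in LHS](_ : \sum_S wedge_cols (K A) S *: ext_basis R S = wedge_cols (K A)).
      by rewrite linear_sum; apply: eq_bigr => S _; rewrite linearZ.
    apply/ffunP => S; rewrite sum_ffunE (bigD1 S) //= !ffunE eqxx big1 ?addr0.
      by rewrite /GRing.scale /= mulr1.
    by move=> T; rewrite !ffunE eq_sym /GRing.scale /= => /negPf ->; rewrite mulr0.
  apply: polyfun_sum => S; apply: polyfun_mul; last exact: polyfun_cst.
  apply: polyfun_wedge_cols => a b.
  pose f (v : 'cV[R]_m) : R^o := v a 0.
  have fl : linear f by move=> c u v; rewrite /f !mxE.
  pose F : {linear 'cV[R]_m -> R^o} := HB.pack f (GRing.isLinear.Build R _ _ _ f fl).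
  under eq_fun do rewrite mxE.
  exact: (polyfun_frame F b).
rewrite /gr_open (_ : mkset _ = B @^-1` [set C | free (frame C) /\ O <<frame C>>%VS])%classic.
  by apply: open_comp Oo => A _; exact: Bc.
apply/seteqP; split=> A; rewrite /preimage /mkset frameB span_seq1 seq1_free wedge_cols_neq0 free_row_full -/(K A).
  by move=> [Kf]; rewrite span_colsp top_power_colsp.
by move=> [Kf]; rewrite span_colsp top_power_colsp.
Qed.

End GrassmannianTopology.

(** * Positive flags *)

Section Flags.
Variables (R : realType) (n : nat).

Lemma span_delta (f : 'I_n -> 'I_(n + n)) :
  <<[seq (delta_mx (f i) ord0 : 'cV[R]_(n + n)) | i : 'I_n]>>%VS =
  colsp (\matrix_(a, j) (a == f j)%:R).
Proof.
transitivity (<<mktuple (fun i => (delta_mx (f i) ord0 : 'cV[R]_(n + n)))>>%VS); first by [].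
rewrite span_colsp; congr colsp; apply/matrixP => a j.
by rewrite !mxE tnth_mktuple mxE andbT.
Qed.

Lemma Lag_colsp : Lag R n = colsp (col_mx 1%:M 0).
Proof.
rewrite /Lag span_delta; congr colsp; apply/matrixP => a j; rewrite !mxE.
case: splitP => b e; rewrite mxE -val_eqE /= e //.
by rewrite gtn_eqF // ltn_addr.
Qed.

Lemma Lag_opp_colsp : Lag_opp R n = colsp (col_mx 0 1%:M).
Proof.
rewrite /Lag_opp span_delta; congr colsp; apply/matrixP => a j; rewrite !mxE.
case: splitP => b e; rewrite mxE -val_eqE /= e ?eqn_add2l //.
by rewrite ltn_eqF // ltn_addr.
Qed.

Lemma act_unip (M : 'M[R]_n) (N : 'M[R]_n) :
  act (unip M) (colsp (col_mx N 1%:M)) = colsp (col_mx (M + N) 1%:M).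
Proof.
by rewrite act_colsp mul_block_col !(mul1mx, mul0mx, mulmx1, add0r) addrC.
Qed.

Lemma act_mulmx m (g h : 'M[R]_m) W : act (g *m h) W = act g (act h W).
Proof.
rewrite /act -limg_comp; congr (_ @: _)%VS; apply/lfunP => c.
by rewrite comp_lfunE !lfunE /= mulmxA.
Qed.

Lemma act1 m W : act (1%:M : 'M[R]_m) W = W.
Proof.
rewrite /act (_ : linfun _ = \1%VF) ?lim1g //.
by apply/lfunP => c; rewrite !lfunE /= mul1mx.
Qed.

Lemma positive_flags3 (Y X Z : {vspace 'cV[R]_(n + n)}) :
  positive_flags [:: Y; X; Z] -> exists (h : 'M[R]_(n + n)) (M : 'M[R]_n),
  [/\ aut_sp h, sym_posdef M, Y = colsp (h *m col_mx 1%:M 0),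
      X = colsp (h *m col_mx M 1%:M) & Z = colsp (h *m col_mx 0 1%:M)].
Proof.
case=> h [Ms [hs _ Mp e]].
have : size Ms = 1%N.
  by have := congr1 size e; rewrite size_map /= size_rev /= size_map size_iota => -[].
case: Ms Mp e => [|M [|N Ms]] // Mp e _; move: e; rewrite /= !(big_cons, big_nil) !mulmx1 act1 Lag_colsp Lag_opp_colsp act_unip !act_colsp.
case=> -> -> ->; exists h, M; split => //; last by rewrite addr0.
by apply: Mp; rewrite inE.
Qed.

(** Four flags force two unipotents. In the reversed list [X] comes from [unip M *m unip N] and [Q]
    from [unip M] alone, hence the graphs of M + N and M. *)
Lemma positive_flags4 (Y X Q Z : {vspace 'cV[R]_(n + n)}) :
  positive_flags [:: Y; X; Q; Z] -> exists (h : 'M[R]_(n + n)) (M N : 'M[R]_n),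
  [/\ aut_sp h, sym_posdef M /\ sym_posdef N, Y = colsp (h *m col_mx 1%:M 0),
      X = colsp (h *m col_mx (M + N) 1%:M) /\ Q = colsp (h *m col_mx M 1%:M)
    & Z = colsp (h *m col_mx 0 1%:M)].
Proof.
case=> h [Ms [hs _ Mp e]].
have : size Ms = 2%N.
  by have := congr1 size e; rewrite size_map /= size_rev /= size_map size_iota => -[].
case: Ms Mp e => [|M [|N [|? Ms]]] // Mp e _; move: e; rewrite /= !(big_cons, big_nil) !mulmx1 act1 act_mulmx Lag_colsp Lag_opp_colsp !act_unip !act_colsp.
case=> -> -> -> ->; exists h, M, N; split => //; last by rewrite !addr0.
by split; apply: Mp; rewrite !inE eqxx ?orbT.
Qed.

Lemma colsp_mul_unit m k (K : 'M[R]_(m, k)) (B : 'M[R]_k) :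
  B \in unitmx -> colsp (K *m B) = colsp K.
Proof.
move=> Bu; apply/eqP; rewrite eqEsubv; apply/andP; split; apply/colspP; first by exists B.
by exists (invmx B); rewrite mulmxK.
Qed.

Lemma aut_sp_diag (A : 'M[R]_n) : A \in unitmx ->
  aut_sp (block_mx A 0 0 (invmx A)^T).
Proof.
move=> Au; split.
  by rewrite unitmxE det_ublock det_tr det_inv mulrV // unitr1.
left; rewrite /Omega tr_block_mx !mulmx_block trmxK !trmx0.
rewrite !(mul0mx, mulmx0, mulmx1, mul1mx, add0r, addr0, mulmxN, mulNmx) -trmx_mul.
by rewrite !mulVmx // trmx1.
Qed.

Lemma aut_spM (g h : 'M[R]_(n + n)) : aut_sp g -> aut_sp h -> aut_sp (g *m h).
Proof.
move=> [gu ge] [hu he]; split; first by rewrite unitmx_mul gu.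
rewrite trmx_mul -!mulmxA [g^T *m _]mulmxA [g^T *m _ *m _]mulmxA.
case: ge => ->; case: he => he; rewrite ?(mulNmx, mulmxN) mulmxA he; [left|right|right|left] => //.
by rewrite opprK.
Qed.

Lemma aut_sp_inv (g : 'M[R]_(n + n)) : aut_sp g -> aut_sp (invmx g).
Proof.
move=> [gu ge]; split; first by rewrite unitmx_inv.
have e (X : 'M[R]_(n + n)) : (invmx g)^T *m (g^T *m X *m g) *m invmx g = X.
  by rewrite !mulmxA -trmx_mul mulmxV // trmx1 mul1mx mulmxK.
case: ge => ge; [left|right].
  by rewrite -{1}ge e.
by rewrite -{2}(e (Omega R n)) ge mulmxN mulNmx opprK.
Qed.

(** With M = A A^T, replacing [h] by h diag(A, A^-T) turns the graph of [M] into the graph of 1 and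
    preserves the two outer flags. *)
Lemma normal_flags3 (Y X Z : {vspace 'cV[R]_(n + n)}) :
  positive_flags [:: Y; X; Z] -> exists h : 'M[R]_(n + n),
  [/\ aut_sp h, Y = colsp (h *m col_mx 1%:M 0),
      X = colsp (h *m col_mx 1%:M 1%:M) & Z = colsp (h *m col_mx 0 1%:M)].
Proof.
case/positive_flags3 => h [M [hs Mp -> -> ->]].
have [A Au eM] := cholesky Mp.
have ATu : (invmx A)^T \in unitmx by rewrite unitmx_tr unitmx_inv.
exists (h *m block_mx A 0 0 (invmx A)^T); split.
- exact/aut_spM/aut_sp_diag.
- rewrite -(colsp_mul_unit _ Au) -!mulmxA mul_block_col mul_col_mx.
  by rewrite !(mul0mx, mulmx0, mulmx1, mul1mx, add0r, addr0).
- rewrite -(colsp_mul_unit _ ATu) -!mulmxA mul_block_col mul_col_mx eM.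
  rewrite !(mul0mx, mulmx0, mulmx1, mul1mx, add0r, addr0).
  by rewrite -mulmxA -trmx_mul mulVmx // trmx1 mulmx1.
- rewrite -(colsp_mul_unit _ ATu) -!mulmxA mul_block_col mul_col_mx.
  by rewrite !(mul0mx, mulmx0, mulmx1, mul1mx, add0r, addr0).
Qed.

(* An element of [aut_sp] fixing both [Lag] and [Lag_opp] is block diagonal,
   with blocks A and +/- A^-T; the sign is determined by the middle flag. *)
Lemma normal_flags4 (h : 'M[R]_(n + n)) (Y X Q Z : {vspace 'cV[R]_(n + n)}) :
  (0 < n)%N -> aut_sp h -> Y = colsp (h *m col_mx 1%:M 0) ->
  X = colsp (h *m col_mx 1%:M 1%:M) -> Z = colsp (h *m col_mx 0 1%:M) ->
  positive_flags [:: Y; X; Q; Z] ->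
  exists P : 'M[R]_n, [/\ sym_posdef P, sym_posdef (1%:M - P)
    & Q = colsp (h *m col_mx P 1%:M)].
Proof.
move=> n0 hs -> -> ->.
case/positive_flags4 => h' [M [N [hs' [Mp Np] Ye [Xe ->] Ze]]].
have hu : h \in unitmx by case: hs.
have hu' : h' \in unitmx by case: hs'.
have [A eA] : exists A, h' *m col_mx 1%:M 0 = h *m col_mx 1%:M 0 *m A.
  by apply/colspP; rewrite Ye subvv.
have [B eB] : exists B, h' *m col_mx 0 1%:M = h *m col_mx 0 1%:M *m B.
  by apply/colspP; rewrite Ze subvv.
pose g := block_mx A 0 0 B.
have gK (K L : 'M[R]_n) : g *m col_mx K L = col_mx (A *m K) (B *m L).
  by rewrite mul_block_col !mul0mx addr0 add0r.
have eh' : h' = h *m g.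
  have e1 : row_mx (col_mx 1%:M 0) (col_mx 0 1%:M) = 1%:M :> 'M[R]_(n + n).
    by rewrite -block_mxEh -scalar_mx_block.
  rewrite -[h']mulmx1 -[g]mulmx1 -e1 !mul_mx_row eA eB !gK -!mulmxA !mul_col_mx.
  by rewrite !(mul1mx, mul0mx, mulmx0, mulmx1).
have gs : aut_sp g.
  by rewrite -[g](mulKmx hu) -eh'; apply: aut_spM => //; exact: aut_sp_inv.
(* [eps] is the sign by which [g] multiplies [Omega]. *)
have [eps [eps2 AB]] : exists eps : R, eps * eps = 1 /\ A^T *m B = eps%:M.
  case: gs => _; rewrite /Omega /g tr_block_mx !mulmx_block !trmx0.
  rewrite !(mul0mx, mulmx0, mulmx1, mul1mx, add0r, addr0, mulmxN, mulNmx) opp_block_mx.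
  case=> /eq_block_mx[_ ABe _ _]; [exists 1|exists (-1)]; rewrite ABe ?mulr1 ?mulrNN ?mulr1; split=> //.
  by rewrite raddfN.
have AtBu : A^T *m (eps *: B) = 1%:M by rewrite -scalemxAr AB scale_scalar_mx eps2.
have Bu : B \in unitmx.
  have := mulmx1_unit AtBu => -[_]; rewrite unitmxZ // unitfE.
  by apply: contra_eq_neq eps2 => ->; rewrite mul0r eq_sym oner_eq0.
have Q' (K : 'M[R]_n) : colsp (h' *m col_mx K 1%:M) =
    colsp (h *m col_mx (eps *: (A *m K *m A^T)) 1%:M).
  rewrite eh' -mulmxA gK -[RHS](colsp_mul_unit _ Bu) -mulmxA mul_col_mx.
  rewrite mul1mx mulmx1 -scalemxAl -mulmxA AB mul_mx_scalar scalerA eps2 scale1r //.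
move: Xe; rewrite !Q' => Xe.
(* The two matrices have the same column space and the same lower block 1, so the change of columns
   [C] is the identity and the upper blocks agree. *)
have Me : 1%:M = eps *: (A *m (M + N) *m A^T).
  have [C] : exists C, h *m col_mx 1%:M 1%:M = h *m col_mx (eps *: (A *m (M + N) *m A^T)) 1%:M *m C.
    by apply/colspP; rewrite Xe subvv.
  rewrite -mulmxA => /(can_inj (mulKmx hu)); rewrite mul_col_mx mul1mx => /eq_col_mx[e1 e2].
  by rewrite {1}e1 -e2 mulmx1.
have At : A \in unitmx by rewrite -unitmx_tr; case/mulmx1_unit: AtBu.
have MNp := sym_posdef_congr At; have {MNp} [Mp' Np'] := (MNp _ Mp, MNp _ Np).
(* With eps = -1, a diagonal entry of the identity would be negative; such an entry exists because n
   > 0. *)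
have eps1 : eps = 1.
  pose i0 := Ordinal n0; move/matrixP/(_ i0 i0): Me.
  rewrite mulmxDr mulmxDl [_ i0 i0]mxE eqxx [_ i0 i0]mxE [X in _ * X]mxE => e.
  have e1 : eps * eps == 1 ^+ 2 by rewrite eps2 expr1n.
  move: e1; rewrite -expr2 eqf_sqr => /orP[/eqP//|/eqP e1].
  have := sym_posdef_entry i0 Mp'; have := sym_posdef_entry i0 Np'.
  move: e; rewrite e1 mulr1n; lra.
(* Since 1 = A (M + N) A^T, the complement 1 - P is A N A^T. *)
exists (A *m M *m A^T); split=> //.
  by rewrite Me eps1 scale1r mulmxDr mulmxDl [_ + A *m N *m _]addrC addrK.
by rewrite eps1 scale1r.
Qed.

End Flags.

(** * The circle *)

Section Circle.
Variable R : realType.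
Local Open Scope complex_scope.

Definition expi (t : R) : R[i] := cos t +i* sin t.

Lemma expiD s t : expi (s + t) = expi s * expi t.
Proof. by rewrite /expi cosD sinD; simpc; rewrite [sin s * _ + _]addrC. Qed.

Lemma norm_expi t : `|expi t| = 1.
Proof. by rewrite normc_def /= cos2Dsin2 sqrtr1. Qed.

Lemma circle_expi_lt0 (w : R[i]) : `|w| = 1 -> w != 1 ->
  exists2 u, - (pi *+ 2) < u < 0 & w = expi u.
Proof.
case: w => a b; rewrite normc_def /= => -[] e w1.
have ab : a ^+ 2 + b ^+ 2 = 1.
  rewrite -[LHS]sqr_sqrtr ?e ?expr1n // addr_ge0 ?sqr_ge0 //.
have a11 : -1 <= a <= 1.
  rewrite -ler_norml -(@ler_pXn2r _ 2) ?nnegrE // real_normK ?num_real // expr1n -ab.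
  by rewrite lerDl sqr_ge0.
have ca := acosK a11.
have sa : sin (acos a) = `|b|.
  rewrite sin_acos // -sqrtr_sqr; congr Num.sqrt; lra.
have a1 : a != 1.
  apply: contra w1 => /eqP a1; move: ab; rewrite a1 expr1n => /eqP.
  by rewrite -subr_eq0 addrAC subrr add0r sqrf_eq0 => /eqP ->.
have p0 := pi_gt0 R.
have ap : 0 < acos a.
  rewrite lt_def acos_ge0 ?a11 // andbT; apply: contra a1 => /eqP e0.
  by rewrite -ca e0 cos0.
have app : acos a <= pi by rewrite acos_lepi ?a11.
(* [acos a] is an angle in (0, pi] with sine |b|. For b >= 0 a full turn is subtracted from it; for
   b < 0 its opposite is taken. *)
have [b0|b0] := leP 0 b.
  exists (acos a - pi *+ 2); first by apply/andP; split; lra.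
  rewrite /expi cosB sinB cos2pi sin2pi ca sa ger0_norm //; congr (_ +i* _); lra.
exists (- acos a); first by apply/andP; split; lra.
by rewrite /expi cosN sinN ca sa ltr0_norm // opprK.
Qed.

(** Lifting the other points to the full turn that ends at [c] turns cyclic order on the circle into
    the order of real angles. *)
Lemma circle_expi_near (c : R) (p : R[i]) : `|p| = 1 -> p <> expi c ->
  exists2 a, c - pi *+ 2 < a < c & p = expi a.
Proof.
move=> p1 pc; have c0 : expi c != 0 by rewrite -normr_gt0 norm_expi ltr01.
have [||u /andP[u0 u1] e] := @circle_expi_lt0 (p / expi c).
- by rewrite normf_div p1 norm_expi divr1.
- by apply/eqP => e; apply: pc; rewrite -[p](divfK c0) e mul1r.
exists (c + u); first by apply/andP; split; lra.
by rewrite expiD -e mulrC divfK.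
Qed.

Lemma circle_expi (p : R[i]) : `|p| = 1 -> exists c, p = expi c.
Proof.
move=> p1; have [->|pn] := eqVneq p 1; first by exists 0; rewrite /expi cos0 sin0.
by have [u _ e] := circle_expi_lt0 p1 pn; exists u.
Qed.

(** Supplies points of the circle arbitrarily close to [expi c] and lying between [expi b] and
    [expi c]. *)
Lemma open_expi_left (O : set R[i]^o) (b c : R) : open O -> O (expi c) -> b < c ->
  exists s, [/\ b < s, s < c & O (expi s)].
Proof.
move=> Oo Oc bc.
have /nbhs_ballP[[e e'] /=] : nbhs (expi c : R[i]^o) O by exact: open_nbhs_nbhs.
(* The radius of the ball is a complex number; being positive, it has zero imaginary part. *)
rewrite ltcE /= => /andP[/eqP e'0 e0]; subst e' => ballO.
have e2 : 0 < e / 2 by rewrite divr_gt0.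
have cosn : \forall s \near c, `|cos c - cos s| < e / 2.
  by have /cvgrPdist_lt/(_ _ e2) := @continuous_cos R c.
have sinn : \forall s \near c, `|sin c - sin s| < e / 2.
  by have /cvgrPdist_lt/(_ _ e2) := @continuous_sin R c.
have : \forall s \near at_left c, [/\ b < s, s < c & O (expi s)].
  near=> s; split.
  - near: s; exact: nbhs_left_gt.
  - near: s; exact: nbhs_left_lt.
  apply: ballO; rewrite -ball_normE /= /ball_ /=.
  have hc : `|cos c - cos s| < e / 2 by near: s; exact: cvg_within.
  have hs : `|sin c - sin s| < e / 2 by near: s; exact: cvg_within.
  rewrite normc_def /= ltcR.
  rewrite -[ltRHS]gtr0_norm // -sqrtr_sqr ltr_sqrt ?exprn_gt0 //.
  have sq (x : R) : `|x| < e / 2 -> x ^+ 2 < (e / 2) ^+ 2.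
    by move=> h; rewrite -real_normK ?num_real // ltr_pXn2r ?nnegrE // ltW.
  have := sq _ hc; have := sq _ hs; rewrite expr_div_n.
  have := exprn_gt0 2 e0; lra.
by move=> /filter_ex.
Unshelve. all: end_near. Qed.

End Circle.

Lemma positive_circle4 (R : realType) (a b s c : R) :
  a < b -> b < s -> s < c -> c < a + pi *+ 2 ->
  positive_circle [:: expi a; expi b; expi s; expi c].
Proof.
move=> ab bs sc ca; exists [:: a; b; s; c]; split => //=; first by rewrite ab bs sc.
have p0 := pi_gt0 R.
by move=> x y; rewrite !inE => /or4P[] /eqP -> /or4P[] /eqP ->; lra.
Qed.

Lemma positive_circle3 (R : realType) (a b c : R) :
  a < b -> b < c -> c < a + pi *+ 2 ->
  positive_circle [:: expi a; expi b; expi c].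
Proof.
move=> ab bc ca; exists [:: a; b; c]; split => //=; first by rewrite ab bc.
have p0 := pi_gt0 R.
by move=> x y; rewrite !inE => /or3P[] /eqP -> /or3P[] /eqP ->; lra.
Qed.

(** * Tangent lines *)

(** If the inequality failed at [w], then [l] would lie in the open cone of [gr_open_cone], and so
    would all secants close to it. On the secant through [v] and [v0], however, ker phi is spanned
    by v - v0, which satisfies the inequality. *)
Lemma tangent_line_bound (R : realType) (V : vectType R) (C : set {vspace V})
    (v0 : V) (l : {vspace V}) (phi psi chi : {linear V -> R^o}) :
  phi v0 != 0 -> tangent_line C <[v0]>%VS l ->
  (forall O : set {vspace V}, gr_open 1 O -> O <[v0]>%VS ->
    exists v, [/\ C <[v]>%VS, <[v]>%VS <> <[v0]>%VS, O <[v]>%VS, phi v = phi v0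
      & `|chi (v - v0)| <= `|psi (v - v0)| ]) ->
  forall w, w \in l -> phi w = 0 -> `|chi w| <= `|psi w|.
Proof.
move=> pv0 [dl v0l tgt] near w wl w0; rewrite leNgt; apply/negP => lt.
have fZ (f : {linear V -> R^o}) c v : f (c *: v) = c * f v by exact: linearZ.
have [|O [Oo Ov0 OU]] := tgt _ (@gr_open_cone _ _ phi psi chi).
  split; last by exists w.
  by exists v0 => //; apply: (subvP v0l); exact: memv_line.
have [v [Cv vv0 Ov pv le]] := near O Oo Ov0.
have [_ [u [/memv_addP[_ /vlineP[a ->] [_ /vlineP[b ->] ->]] u0]]] := OU _ Cv vv0 Ov.
(* For u = a v0 + b v, phi u = (a + b) phi v0 = 0 gives a = -b and u = b (v - v0). *)
move: u0; rewrite linearD !fZ pv -mulrDl => /eqP.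
rewrite mulf_eq0 (negPf pv0) orbF addr_eq0 => /eqP ->.
rewrite scaleNr addrC -scalerBr !fZ !normrM => h.
have b0 : 0 < `|b|.
  by rewrite normr_gt0; apply: contraTneq h => ->; rewrite normr0 !mul0r ltxx.
by move: h; rewrite ltr_pM2l // ltNge le.
Qed.

(** * Plücker vectors in an affine chart and the secant estimate *)

Section Functionals.
Variables (R : realType) (n : nat).

Definition omega_fun (v : extalg R (n + n)) (w : extalg R (n + n)) : R^o := omega' v w.

HB.instance Definition _ v := GRing.isLinear.Build R (extalg R (n + n)) R^o _
  (omega_fun v) (omega'_linearr v).

Definition ext_coord (m : nat) (S : {set 'I_m}) (w : extalg R m) : R^o := w S.

Fact ext_coord_linear m S : linear (@ext_coord m S).
Proof. by move=> a u v; rewrite /ext_coord !ffunE. Qed.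

HB.instance Definition _ m (S : {set 'I_m}) := GRing.isLinear.Build R (extalg R m) R^o _
  (@ext_coord m S) (@ext_coord_linear m S).

(** Plücker vector of the [h]-image of the graph of [M], seen as a map from [Lag_opp] to [Lag]; M =
    0 gives the image of [Lag_opp]. *)
Definition chart (h : 'M[R]_(n + n)) (M : 'M[R]_n) : extalg R (n + n) :=
  wedge_cols (h *m col_mx M 1%:M).

Lemma row_full_mul m k (h : 'M[R]_m) (K : 'M[R]_(m, k)) :
  h \in unitmx -> row_full K -> row_full (h *m K).
Proof.
move=> hu /row_fullP[B BK]; apply/row_fullP; exists (B *m invmx h).
by rewrite -mulmxA mulKmx.
Qed.

Lemma top_power_chart (h : 'M[R]_(n + n)) M : h \in unitmx ->
  top_power (colsp (h *m col_mx M 1%:M)) = <[chart h M]>%VS.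
Proof.
move=> hu; apply/top_power_colsp/row_full_mul => //; apply/row_fullP.
by exists (row_mx 0 1%:M); rewrite mul_row_col mul0mx mul1mx add0r.
Qed.

Lemma top_power_Lag (h : 'M[R]_(n + n)) : h \in unitmx ->
  top_power (colsp (h *m col_mx 1%:M 0)) = <[wedge_cols (h *m col_mx 1%:M 0)]>%VS.
Proof.
move=> hu; apply/top_power_colsp/row_full_mul => //; apply/row_fullP.
by exists (row_mx 1%:M 0); rewrite mul_row_col mul0mx mul1mx addr0.
Qed.

(** The value does not depend on [M], so differences of chart vectors are orthogonal to the Plücker
    vector of the image of [Lag]. *)
Lemma omega_Lag_chart (h : 'M[R]_(n + n)) M :
  omega' (wedge_cols (h *m col_mx 1%:M 0)) (chart h M) = \det h.
Proof.
by rewrite omega'_wedge_cols -mul_mx_row det_mulmx -block_mxEh det_ublock !det1 !mulr1.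
Qed.

Lemma omega_chart1_chart (h : 'M[R]_(n + n)) M : omega' (chart h 1%:M) (chart h M) =
  \det h * \det (1%:M - M).
Proof.
rewrite omega'_wedge_cols -mul_mx_row det_mulmx -block_mxEh; congr (_ * _).
have -> : block_mx 1%:M M 1%:M 1%:M =
    block_mx 1%:M 0 1%:M 1%:M *m block_mx 1%:M M 0 (1%:M - M) :> 'M[R]_(n + n).
  by rewrite mulmx_block !(mulmx1, mul1mx, mul0mx, mulmx0, addr0, add0r) subrKC.
by rewrite det_mulmx det_lblock det_ublock !det1 !mul1r.
Qed.

(** [polyfun_lipschitz] at the zero matrix, with the trace as distance: it dominates the entries of
    [P] and is at most [n]. *)
Lemma chart_bound (h : 'M[R]_(n + n)) S : exists C, forall P : 'M[R]_n,
  sym_posdef P -> sym_posdef (1%:M - P) ->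
  `|chart h P S - chart h 0 S| <= C * \tr P.
Proof.
pose D (P : 'M[R]_n) := sym_posdef P /\ sym_posdef (1%:M - P).
have [|||C hC] := @polyfun_lipschitz R _ _ (@entry R n n) D 0 (fun P => \tr P) n%:R _ _
    (fun P => chart h P S).
- move=> P [Pp Qp]; have [_ ->] := det_1B_bound Pp Qp.
  by rewrite andbT sumr_ge0 // => i _; rewrite ltW ?sym_posdef_entry.
- case=> i j; exists 1 => P [Pp _].
  by rewrite /entry mxE subr0 mul1r sym_posdef_entry_le.
- apply: polyfun_wedge_cols; apply: polyfun_mulmxl => i j.
  case: (split_ordP i) => k ->.
    under eq_fun do rewrite col_mxEu.
    exact: (polyfun_gen _ (k, j)).
  under eq_fun do rewrite col_mxEd.
  exact: polyfun_cst.
by exists C => P Pp Qp; apply: hC.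
Qed.

Lemma chart_secant_bound (h : 'M[R]_(n + n)) S : h \in unitmx ->
  exists C, forall P : 'M[R]_n, sym_posdef P -> sym_posdef (1%:M - P) ->
  `|ext_coord S (chart h P - chart h 0)| <=
  `|C * omega' (chart h 1%:M) (chart h P - chart h 0)|.
Proof.
move=> hu; have [C hC] := chart_bound h S.
have d0 : \det h != 0 by rewrite -unitfE -unitmxE.
(* The pairing with the secant is -det h (1 - det(1 - P)), and tr P <= n (1 - det(1 - P)): the
   factor [n] comes from the trace bound and the division removes [\det h]. *)
exists (C * n%:R / \det h) => P Pp Qp.
have := hC P Pp Qp; have [tr1 _] := det_1B_bound Pp Qp.
have tr0 : 0 <= \tr P by rewrite sumr_ge0 // => i _; rewrite ltW ?sym_posdef_entry.
have -> : omega' (chart h 1%:M) (chart h P - chart h 0) = - (\det h * (1 - \det (1%:M - P))).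
  rewrite -[LHS]/(omega_fun _ _) linearB /= /omega_fun !omega_chart1_chart.
  by rewrite subr0 det1; ring.
have -> : C * n%:R / \det h * - (\det h * (1 - \det (1%:M - P))) =
    - (C * (n%:R * (1 - \det (1%:M - P)))) by field.
rewrite /ext_coord !ffunE normrN normrM => le.
apply: (le_trans le); apply: (@le_trans _ _ (`|C| * \tr P)).
  by rewrite ler_wpM2r // ler_norm.
by rewrite ler_wpM2l // (le_trans tr1) // ler_norm.
Qed.

End Functionals.

(** * Independence of the three subspaces *)

Lemma directv_add3 (R : realType) (V : vectType R) (A B W : {vspace V}) :
  (forall u v, u \in A -> v \in B -> u + v \in W -> u = 0 /\ v = 0) ->
  directv (A + B + W).
Proof.
move=> h.
have AB : (A :&: B = 0)%VS.
  apply/eqP; rewrite -subv0; apply/subvP => u; rewrite memv_cap => /andP[uA uB].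
  have [-> _] : u = 0 /\ - u = 0 by apply: h; rewrite ?rpredN // subrr mem0v.
  exact: mem0v.
have ABW : ((A + B) :&: W = 0)%VS.
  apply/eqP; rewrite -subv0; apply/subvP => w; rewrite memv_cap => /andP[].
  move=> /memv_addP[u uA [v vB ->]] uvW; have [-> ->] := h u v uA vB uvW.
  by rewrite addr0 mem0v.
by rewrite directvE /= !dimv_disjoint_sum.
Qed.

(** A combination s v_a + t v_b in the annihilator is tested on two vectors of [l]: one in ker phi
    gives t = 0, and the Plücker vector at [c] gives s = 0. *)
Lemma ordered_triple_independent (R : realType) (n : nat) (G : set 'M[R]_2)
    (rho : 'M[R]_2 -> 'M[R]_(n + n))
    (xi : R[i] -> {vspace 'cV[R]_(n + n)})
    (a b c : R) (l : {vspace extalg R (n + n)}) :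
  (0 < n)%N -> limit_set G = @circle R -> limit_map G rho xi ->
  a < b -> b < c -> c < a + pi *+ 2 ->
  tangent_line [set top_power (xi p) | p in limit_set G]%classic
    (top_power (xi (expi c))) l ->
  forall u v, u \in top_power (xi (expi a)) -> v \in top_power (xi (expi b)) ->
    u + v \in Ann l -> u = 0 /\ v = 0.
Proof.
move=> n0 GC [_ xic _ xip] ab bc ca tgt.
have onC t : limit_set G (expi t) by rewrite GC /circle /mkset norm_expi.
have onCs (s : seq R) p : p \in map (@expi R) s -> limit_set G p.
  by case/mapP => t _ ->.
have [h [hs xia xib xic']] : exists h : 'M[R]_(n + n),
  [/\ aut_sp h, xi (expi a) = colsp (h *m col_mx 1%:M 0),
      xi (expi b) = colsp (h *m col_mx 1%:M 1%:M)
    & xi (expi c) = colsp (h *m col_mx 0 1%:M)].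
  apply: normal_flags3; apply: (xip [:: expi a; expi b; expi c]) => //.
    exact: (onCs [:: a; b; c]).
  exact: positive_circle3.
have hu : h \in unitmx by case: hs.
have d0 : \det h != 0 by rewrite -unitfE -unitmxE.
pose phi : {linear extalg R (n + n) -> R^o} := omega_fun (wedge_cols (h *m col_mx 1%:M 0)).
pose psi : {linear extalg R (n + n) -> R^o} := omega_fun (chart h 1%:M).
have phiC M : phi (chart h M) = \det h by exact: omega_Lag_chart.
have psiC M : psi (chart h M) = \det h * \det (1%:M - M) by exact: omega_chart1_chart.
move: tgt; rewrite xia xib xic' top_power_chart // top_power_chart // top_power_Lag // => tgt.
(* One constant per coordinate suffices: the bounds are used only to show that a vector of [l] on
   which [phi] and [psi] vanish is zero. *)
have bound S : exists C, forall w, w \in l -> phi w = 0 -> `|w S| <= `|C * psi w|.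
  have [C hC] := chart_secant_bound S hu; exists C.
  pose psiC' : {linear extalg R (n + n) -> R^o} := C \*: psi.
  apply: (@tangent_line_bound _ _ _ _ _ phi psiC' (@ext_coord R _ S) _ tgt).
    by rewrite phiC.
  move=> O Oo Oc.
  (* The neighbourhood [O] is pulled back to Lagrangians by the Plücker map, then to the circle by
     [xi]. *)
  have [N No Ne] := xic _ (gr_open_top_power Oo).
  have Nc : N (expi c).
    have : (limit_set G `&` xi @^-1` [set W | O (top_power W)])%classic (expi c).
      by split => //=; rewrite xic' top_power_chart.
    by rewrite Ne => -[].
  have [s [bs sc Ns]] := open_expi_left No Nc bc.
  have Os : O (top_power (xi (expi s))).
    have : (limit_set G `&` N)%classic (expi s) by [].
    by rewrite -Ne => -[].
  have [P [Pp Qp xis]] : exists P : 'M[R]_n, [/\ sym_posdef P, sym_posdef (1%:M - P)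
      & xi (expi s) = colsp (h *m col_mx P 1%:M)].
    apply: normal_flags4 xia xib xic' _ => //.
    apply: (xip [:: expi a; expi b; expi s; expi c]) => //.
      exact: (onCs [:: a; b; s; c]).
    exact: positive_circle4.
  rewrite xis top_power_chart // in Os.
  exists (chart h P); split => //.
  - by exists (expi s); rewrite //= xis top_power_chart.
  (* If the two lines agreed, [phi] would force the ratio k = 1 and [psi] would force det(1 - P) =
     1, so tr P <= 0, against positivity of [P]. *)
  - move=> e; have : chart h P \in <[chart h 0]>%VS by rewrite -e memv_line.
    case/vlineP => k ek.
    have := phiC P; rewrite ek.
    have -> : phi (k *: chart h 0) = k * phi (chart h 0) by exact: linearZ.
    rewrite phiC => /(canRL (mulfK d0)); rewrite divff // => k1.
    have := psiC P; rewrite ek k1 scale1r psiC subr0 det1 mulr1 => /esym.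
    rewrite -[RHS]mulr1 => /(mulfI d0) e1.
    have [] := det_1B_bound Pp Qp; rewrite e1 subrr mulr0 leNgt.
    by rewrite sym_posdef_trace_gt0.
  - by rewrite !phiC.
  exact: hC.
move=> u v /vlineP[s ->] /vlineP[t ->] /memv_Ann[_ uvl].
have cl : chart h 0 \in l by case: tgt => _ /subvP cl _; exact/cl/memv_line.
have omegaE w : w \in l -> s * phi w + t * psi w = 0.
  move=> wl; rewrite -[RHS](uvl w wl).
  pose F : {linear extalg R (n + n) -> R^o} := HB.pack (fun v => omega' v w : R^o)
    (GRing.isLinear.Build R _ _ _ _ (@omega'_linearl R n w)).
  rewrite -[RHS]/(F _) linearD; congr (_ + _); apply/esym; exact: linearZ.
have [w [wl w0 phiw]] : exists w, [/\ w \in l, w != 0 & phi w = 0].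
  have : ~~ (l <= <[chart h 0]>)%VS.
    by case: tgt => dl _ _; apply/negP => /dimvS; rewrite dl dim_vline; case: (_ != _).
  (* A vector of the plane [l] off the line of [chart h 0] is projected to ker phi along that line;
     [\det h] is the value of [phi] on [chart h 0]. *)
  move=> /subvPn[x xl xn]; exists (x - (phi x / \det h) *: chart h 0); split.
  - by rewrite rpredB // rpredZ.
  - by apply: contra xn; rewrite subr_eq0 => /eqP ->; rewrite memvZ // memv_line.
  have phiZ k y : phi (k *: y) = k * phi y by exact: linearZ.
  by rewrite linearB phiZ phiC divfK // subrr.
have psiw : psi w != 0.
  apply: contra w0 => /eqP pw; apply/eqP/ffunP => S; rewrite ffunE.
  have [C /(_ w wl phiw)] := bound S.
  by rewrite pw mulr0 normr0 normr_le0 => /eqP.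
have t0 : t = 0.
  by have /eqP := omegaE w wl; rewrite phiw mulr0 add0r mulf_eq0 (negPf psiw) orbF => /eqP.
have s0 : s = 0.
  by have /eqP := omegaE _ cl; rewrite t0 mul0r addr0 phiC mulf_eq0 (negPf d0) orbF => /eqP.
by rewrite s0 t0 !scale0r.
Qed.

Local Open Scope classical_set_scope.
Local Open Scope ring_scope.

Theorem proposition3p3 (R : realType) (n : nat) (G : set 'M[R]_2)
    (rho : 'M[R]_2 -> 'M[R]_(n + n))
    (xi : R[i] -> {vspace 'cV[R]_(n + n)})
    (x y z : R[i]) (l : {vspace extalg R (n + n)}) :
  (1 < n)%N ->
  psl_subgroup G -> psl_discrete G -> non_elementary G ->
  limit_set G = @circle R ->
  symplectic_rep G rho -> maximal_rep G rho -> limit_map G rho xi ->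
  limit_set G x -> limit_set G y -> limit_set G z ->
  x <> y -> y <> z -> x <> z ->
  tangent_line [set top_power (xi p) | p in limit_set G] (top_power (xi z)) l ->
  directv (top_power (xi x) + top_power (xi y) + Ann l).
Proof.
move=> n1 _ _ _ GC _ _ lim Gx Gy Gz xy yz xz tgt.
have n0 : (0 < n)%N := ltnW n1.
have circ p : limit_set G p -> `|p| = 1 by rewrite GC.
have [c zc] := circle_expi (circ _ Gz); rewrite zc in tgt yz xz.
have [a /andP[ca ac] ya] := circle_expi_near (circ _ Gy) yz.
have [b /andP[cb bc] xb] := circle_expi_near (circ _ Gx) xz.
apply: directv_add3 => u v; rewrite ya xb => uX vY uvl.
(* The angles of [y] and [x] are [a] and [b]. Whichever comes first plays the role of [Lag]; the
   claim is symmetric in the two points. *)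
have [ab|ba|ab] := ltgtP a b; last by case: xy; rewrite xb ya ab.
  have ca' : c < a + pi *+ 2 by rewrite -ltrBlDr.
  have [] := ordered_triple_independent n0 GC lim ab bc ca' tgt vY uX; last by move=> -> ->.
  by rewrite addrC.
have cb' : c < b + pi *+ 2 by rewrite -ltrBlDr.
exact: (ordered_triple_independent n0 GC lim ba ac cb' tgt uX vY uvl).
Qed.
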